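(* Let $m>1$, let $p=(p_1,\dots,p_m)\in\{0,1\}^m$ be a binary vector whose zeros are located exactly at the positions $i_1<i_2<\dots<i_r$, with $i_r=m$, and let $\mathcal P=(p)^*=(p_1,p_2,\dots)$ be the infinite periodic up-down sequence with period $p$, so $p_{i+m}=p_i$ (with indices of $p$ read modulo $m$). For $0\le l\le m-1$ consider the two-point spectral problem on $[0,1]$ $$u^{(m)}=(-1)^r\lambda^m u$$ with the $m$ homogeneous boundary conditions, for $i=0,1,\dots,m-1$, $$u^{(i)}(0)=0\ \text{ if } p_{m+l-i-1}=1,\qquad u^{(i)}(1)=0\ \text{ if } p_{m+l-i-1}=0 .$$ Let $\lambda$ be the first eigenvalue of this problem and $u^{\mathcal P}_l$ the corresponding first eigenfunction, normalized by $\max_{0\le t\le 1}u^{\mathcal P}_l(t)=1$. Then, for the given sequence $\mathcal P$ and any $l$, $0\le l\le m-1$, $$\lim_{n\to\infty,\ \frac{j}{mn+l}\to t}\ \frac{\sharp^{\mathcal P}_{mn+l,j}\,\lambda^{mn+l}}{(mn+l-1)!}=c_{m,l}\,u^{\mathcal P}_l(t),$$ where $c_{m,l}$ is a constant depending only on $m$ and $l$. Moreover, the first eigenvalue $\lambda$ of the two-point spectral problem $u^{(m)}=(-1)^r\lambda^m u$ on $[0,1]$ with the boundary conditions, for $i=0,1,\dots,m-1$, $u^{(i)}(0)=0$ if $p_{m+l-i-1}=1$ and $u^{(i)}(1)=0$ if $p_{m+l-i-1}=0$, is the minimal absolute value among the solutions $t\in\mathbb C$ of the equation $\det M^{\mathcal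 P}(t)=0$, where $M^{\mathcal P}(t)$ is the $r\times r$ matrix $$M^{\mathcal P}(t)=\begin{pmatrix} \varphi_{m,0}&\varphi_{m,m-i_1}&\varphi_{m,m-i_2}&\cdots&\varphi_{m,m-i_{r-1}}\\ \varphi_{m,i_1}&\varphi_{m,0}&\varphi_{m,m+i_1-i_2}&\cdots&\varphi_{m,m+i_1-i_{r-1}}\\ \varphi_{m,i_2}&\varphi_{m,i_2-i_1}&\varphi_{m,0}&\cdots&\varphi_{m,m+i_2-i_{r-1}}\\ \vdots&\vdots&\vdots&\ddots&\vdots\\ \varphi_{m,i_{r-1}}&\varphi_{m,i_{r-1}-i_1}&\varphi_{m,i_{r-1}-i_2}&\cdots&\varphi_{m,0} \end{pmatrix}$$ with $\varphi_{m,j}=\varphi_{m,j}(t)$.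
   Context: The up-down sequence of a permutation $\sigma=(\sigma_1,\dots,\sigma_n)$ of $\{1,\dots,n\}$ is the binary vector of length $n-1$ whose $i$-th entry is $1$ if $\sigma_i<\sigma_{i+1}$ and $0$ otherwise. For an infinite binary sequence $\mathcal P=(p_1,p_2,\dots)$, $\sharp^{\mathcal P}_{i,j}$ ($1\le j\le i$) is the number of permutations of length $i$ whose up-down sequence is $(p_1,\dots,p_{i-1})$ and whose last entry equals $j$. The Olivier functions of the $m$-th order are $\varphi_{m,i}(t)=\sum_{j=0}^{\infty}\frac{t^{jm+i}}{(jm+i)!}$, $0\le i\le m-1$ (entire functions of $t$). Setting $i_0=0$ and indexing rows and columns by $k,l\in\{0,\dots,r-1\}$, the $(k,l)$ entry of $M^{\mathcal P}(t)$ is $\varphi_{m,(i_k-i_l)\bmod m}(t)$. The first eigenvalue of the spectral problem is the smallest $\lambda>0$ for which the problem has a nonzero solution $u$, and a first eigenfunction is such a nonzero solution. The limit is understood for $t\in[0,1]$: $n\to\infty$ and $j=j(n)$ with $1\le j\le mn+l$ varies so that $j/(mn+l)\to t$. The sequence $\mathcal P$ is fixed throughout; the constant $c_{m,l}$ does not depend on $n$, $j$, $t$. *)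

(* Defs.v *)
From HB Require Import structures.
From mathcomp Require Import all_boot all_order all_fingroup all_algebra.
From mathcomp Require Import complex.
From mathcomp Require Import all_classical all_reals all_analysis.

Set Implicit Arguments.
Unset Strict Implicit.
Unset Printing Implicit Defensive.

Import Order.TTheory GRing.Theory Num.Theory.
Import numFieldNormedType.Exports.

Local Open Scope classical_set_scope.
Local Open Scope ring_scope.

(* The m-periodic sequence P = (p)^*, indexed from 1: P k is the entry p_k of
   p, stored at position k - 1 of the tuple, with k read modulo m. In
   particular P 0 = p_m. *)
Definition periodic_seq (m : nat) (p : m.-tuple bool) (k : nat) : bool :=
  nth false p ((k + m.-1) %% m)%N.

(* The increasing list i_1 < ... < i_r of the positions (from 1) of the zeros
   of p; its size is r. *)
Definition zeros (m : nat) (p : m.-tuple bool) : seq nat :=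
  [seq k <- iota 1 m | ~~ periodic_seq p k].

(* The one-line notation (sigma_1, ..., sigma_n), with values in {1, ..., n}. *)
Definition one_line (n : nat) (s : 'S_n) : seq nat :=
  [seq (s x : nat).+1 | x <- enum 'I_n].

Definition up_down (w : seq nat) : seq bool :=
  mkseq (fun k => nth 0 w k < nth 0 w k.+1)%N (size w).-1.

(* The number of permutations of length i with up-down sequence
   (P 1, ..., P (i - 1)) and last entry j. *)
Definition sharp (P : nat -> bool) (i j : nat) : nat :=
  #|[pred s : 'S_i | (up_down (one_line s) == mkseq (fun k => P k.+1) i.-1)
                     && (last 0%N (one_line s) == j)]|.

(* g is the derivative of f relative to A, one-sided at the endpoints when A
   is a closed interval. *)
Definition derivative_on (R : realType) (A : set R) (f g : R -> R) : Prop :=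
  forall x, A x -> (f y - f x) / (y - x) @[y --> within A x^'] --> g x.

(* v i plays the role of u^(i) on [0, 1]. The index m + l - i - 1 is a true
   natural subtraction since i <= m - 1; it is 0, read as m, when l = 0 and
   i = m - 1. *)
Definition spectral_solution (R : realType) (m : nat) (p : m.-tuple bool)
    (l : nat) (lambda : R) (u : R -> R) : Prop :=
  exists v : nat -> R -> R,
  [/\ v 0%N = u,
      forall i, (i < m)%N -> derivative_on `[0, 1] (v i) (v i.+1),
      forall x, x \in `[0, 1] ->
        v m x = (-1) ^+ size (zeros p) * lambda ^+ m * u x
    & forall i, (i < m)%N ->
        if periodic_seq p (m + l - i - 1) then v i 0 = 0 else v i 1 = 0].

(* Functions are total on R but only their values on [0, 1] are relevant. *)
Definition eigenfunction (R : realType) (m : nat) (p : m.-tuple bool)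
    (l : nat) (lambda : R) (u : R -> R) : Prop :=
  spectral_solution p l lambda u /\ exists2 x, x \in `[0, 1] & u x != 0.

Definition first_eigenvalue (R : realType) (m : nat) (p : m.-tuple bool)
    (l : nat) (lambda : R) : Prop :=
  [/\ 0 < lambda,
      exists u, eigenfunction p l lambda u
    & forall mu : R, 0 < mu -> (exists u, eigenfunction p l mu u) ->
        lambda <= mu].

Definition max_on01 (R : realType) (u : R -> R) (M : R) : Prop :=
  (forall x, x \in `[0, 1] -> u x <= M) /\ exists2 x, x \in `[0, 1] & u x = M.

(* Stated over an arbitrary numFieldType C, whose topology is that of the norm;
   used below with C = R[i]. *)
Definition olivier (C : numFieldType) (m i : nat) (t : C) : C :=
  limn (series (fun j : nat => t ^+ (j * m + i) / (j * m + i)`!%:R)).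

(* nth 0 (0 :: zeros p) k is i_k, with i_0 = 0. Since i_l <= m, the index
   (i_k + (m - i_l)) %% m is (i_k - i_l) mod m. *)
Definition olivier_matrix (R : realType) (m : nat) (p : m.-tuple bool)
    (t : R[i]) : 'M[R[i]]_(size (zeros p)) :=
  \matrix_(k, l) olivier m ((nth 0 (0 :: zeros p) k
                             + (m - nth 0 (0 :: zeros p) l)) %% m)%N t.

(* Main.v *)
Require Import Defs.
From HB Require Import structures.
From mathcomp Require Import all_boot all_order all_fingroup all_algebra.
From mathcomp Require Import complex.
From mathcomp Require Import all_classical all_reals all_analysis.
From mathcomp Require Import ring lra zify.

Set Implicit Arguments.
Unset Strict Implicit.
Unset Printing Implicit Defensive.

Import Order.TTheory GRing.Theory Num.Theory.
Import numFieldNormedType.Exports.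

Local Open Scope classical_set_scope.
Local Open Scope ring_scope.

(* For a nonnegative function u put T_1 u (x) = int_0^x u and
   T_0 u (x) = int_x^1 u.  If n points are drawn uniformly in [0, 1] and have
   up-down sequence (p_1, ..., p_(n-1)), the density of the last one is
   f_n = T_(p_(n-1)) ... T_(p_1) 1, and f_n is the Bernstein polynomial whose
   coefficients are the numbers sharp_(n,j) / (n-1)!.  An eigenfunction of the
   spectral problem is, up to signs, an eigenfunction of the composition of the
   operators over one period, with eigenvalue lambda^-m.

   A block 0 1 ... 1 0 maps every nonnegative function to one comparable with
   1 - x, so the oscillation of the ratio of two sequences obeying the
   recursion contracts geometrically (Hopf, Birkhoff).  Comparing f_(n+m) with
   f_n gives a rate gam and a positive limit F of the rescaled f_n.  Any
   eigenfunction grows at most like f_n, so lambda0 = gam^(-1/m) is the first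
   eigenvalue and its eigenspace is spanned by F.  The numbers
   sharp_(n,j) / (n-1)! are Lipschitz in j/n at the scale of f_n, so they have
   the same limit as the Bernstein polynomial they define.

   Taylor expansion at 0 identifies the kernel of the Olivier matrix at t with
   the complex solutions of u^(m) = t^m u satisfying the boundary conditions;
   their real and imaginary parts obey the recursion, hence |t| >= lambda0. *)

(** * Differentiation on the unit interval *)

(** The operators T_b enter only as a relation, a derivative together with a vanishing endpoint
    value, so densities, their limits, and real and imaginary parts of exponential series are all
    instances of one recursion. Its positivity needs only a mean value inequality.

    The obstacle to contraction is that every image vanishes at an endpoint, so positive functions
    need not be comparable up to constants. The block 0 1 ... 1 0 supplies a fixed profile for the
    comparison; it exists only if p contains a 1. If p consists of zeros, the densities (1 - x)^n /
    n! decay faster than any geometric sequence, no positive eigenvalue exists and both claims are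
    vacuous.

    The geometric rate matters because it is summable: this makes the rescaled densities converge,
    and to a nonzero limit. Domination by the densities holds for functions of any sign, hence for
    complex solutions; one growth bound thus keeps determinant roots, and with them the eigenvalues,
    which are moduli of such roots, from falling below lambda0. The constant c_(m,l) is
    lambda0^(m+l) times the supremum of F_(m+l-1). *)

(** If the supremum of the points satisfying [S] were below [b], the step there would carry [S] past
    it. This form of connectedness underlies the mean value inequality and the boundedness of
    differentiable functions. *)
Lemma real_induction (R : realType) (a b : R) (S : R -> Prop) :
  a <= b -> S a ->
  (forall s, a <= s <= b -> exists2 d, 0 < d &
     forall z z', a <= z <= s -> s <= z' <= b -> s - d < z -> z' < s + d ->
       S z -> S z') ->
  S b.
Proof.
move=> ab Sa step.
pose A := [set z | a <= z <= b /\ S z].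
have supA : has_sup A.
  by split; [exists a; split; rewrite ?lexx | exists b => z [/andP[]]].
have s_ub z : A z -> z <= sup A by move=> Az; apply: ub_le_sup => //; case: supA.
have as_ : a <= sup A by apply: s_ub; split; rewrite ?lexx.
have sb : sup A <= b by apply: ge_sup; [case: supA | move=> z [/andP[]]].
have [|d d0 hd] := step (sup A); first by rewrite as_.
have [z [/andP[az zb] Sz] sz] := sup_adherent d0 supA.
have zs : z <= sup A by apply: s_ub; split; rewrite ?az.
have h z' : sup A <= z' <= b -> z' < sup A + d -> S z'.
  by move=> hz' hz'd; apply: (hd z z') => //; rewrite az zs.
have [sb'|] := ltP (sup A) b; last first.
  by move=> bs; apply: h; rewrite ?sb ?lexx //; lra.
have [] := ltP (Num.min b (sup A + d / 2)) (sup A).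
  by rewrite gt_min; lra.
move=> _.
have Sm : S (Num.min b (sup A + d / 2)).
  by apply: h; rewrite ?le_min ?ge_min ?gt_min ?lt_min ?lexx ?sb //=; lra.
have : Num.min b (sup A + d / 2) <= sup A.
  by apply: s_ub; split=> //; rewrite ge_min lexx le_min ab /=; lra.
by rewrite ge_min; lra.
Qed.

(* The epsilon-delta form of [derivative_on] for the interval [0, 1]. *)
Definition deriv01 (R : realType) (f g : R -> R) :=
  forall x, 0 <= x <= 1 -> forall e, 0 < e ->
  exists2 d, 0 < d & forall y, 0 <= y <= 1 -> `|y - x| < d ->
    `|f y - f x - g x * (y - x)| <= e * `|y - x|.

Lemma derivative_onP (R : realType) (f g : R -> R) :
  derivative_on `[0, 1] f g <-> deriv01 f g.
Proof.
split=> [fg x x01 e e0|fg x /=]; last first.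
  rewrite in_itv /= => x01; apply/cvgrPdist_le => e e0.
  have [d d0 hd] := fg x x01 e e0.
  rewrite near_withinE /dnbhs near_withinE; apply/nbhs_ballP; exists d => //= y.
  rewrite /ball /= distrC in_itv /= => yxd /eqP yx y01.
  have yx0 : y - x != 0 by rewrite subr_eq0; apply/eqP.
  have -> : g x - (f y - f x) / (y - x) = - (f y - f x - g x * (y - x)) / (y - x).
    by field.
  by rewrite normrM normrN normfV ler_pdivrMr ?normr_gt0 //; apply: hd.
have := fg x; rewrite /= in_itv /= => /(_ x01) /cvgrPdist_le /(_ e e0).
rewrite near_withinE /dnbhs near_withinE => /nbhs_ballP [d /= d0 hd].
exists d => // y y01 yxd.
have [->|/eqP yx] := eqVneq y x; first by rewrite !subrr mulr0 subrr !normr0 mulr0.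
have yx0 : y - x != 0 by rewrite subr_eq0; apply/eqP.
have := hd y; rewrite /ball /= in_itv /= distrC => /(_ yxd).
move=> /(_ (introN eqP yx) y01).
have -> : g x - (f y - f x) / (y - x) = - (f y - f x - g x * (y - x)) / (y - x).
  by field.
by rewrite normrM normrN normfV ler_pdivrMr ?normr_gt0.
Qed.

Section Deriv01.
Variable R : realType.
Implicit Types (f g h k : R -> R) (x y c : R).

Lemma deriv01_id : deriv01 (fun x => x) (fun=> 1).
Proof.
by move=> x x01 e e0; exists 1 => // y _ _; rewrite mul1r subrr normr0 mulr_ge0 // ltW.
Qed.

Lemma deriv01_cst c : deriv01 (fun=> c) (fun=> 0).
Proof.
move=> x x01 e e0; exists 1 => // y _ _.
by rewrite subrr mul0r subrr normr0 mulr_ge0 // ltW.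
Qed.

Lemma deriv01D f g h k : deriv01 f g -> deriv01 h k ->
  deriv01 (fun x => f x + h x) (fun x => g x + k x).
Proof.
move=> fg hk x x01 e e0; have e20 : 0 < e / 2 by rewrite divr_gt0.
have [d d0 hd] := fg x x01 _ e20; have [d' d'0 hd'] := hk x x01 _ e20.
exists (Num.min d d'); first by rewrite lt_min d0.
move=> y y01; rewrite lt_min => /andP[yd yd'].
have -> : f y + h y - (f x + h x) - (g x + k x) * (y - x) =
  (f y - f x - g x * (y - x)) + (h y - h x - k x * (y - x)) by ring.
apply: le_trans (ler_normD _ _) _.
have := hd y y01 yd; have := hd' y y01 yd'; lra.
Qed.

Lemma deriv01_mulx f g : deriv01 f g ->
  deriv01 (fun x => x * f x) (fun x => f x + x * g x).
Proof.
move=> fg x x01 e e0; have e20 : 0 < e / 2 by rewrite divr_gt0.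
have g1 : 0 < 1 + `|g x| by have := normr_ge0 (g x); lra.
have [d d0 hd] := fg x x01 _ e20; have [d' d'0 hd'] := fg x x01 1 ltr01.
exists (Num.min (Num.min d d') (e / 2 / (1 + `|g x|))).
  by rewrite !lt_min d0 d'0 divr_gt0.
move=> y y01; rewrite !lt_min => /andP[/andP[yd yd'] yd''].
have -> : y * f y - x * f x - (f x + x * g x) * (y - x) =
  x * (f y - f x - g x * (y - x)) + (y - x) * ((f y - f x - g x * (y - x)) + g x * (y - x)).
  by ring.
apply: le_trans (ler_normD _ _) _; rewrite !normrM.
have h1 : `|x| * `|f y - f x - g x * (y - x)| <= e / 2 * `|y - x|.
  apply: le_trans (hd y y01 yd); apply: ler_piMl; first exact: normr_ge0.
  by rewrite [`|x|]ger0_norm; lra.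
have h2 : `|f y - f x - g x * (y - x) + g x * (y - x)| <= e / 2.
  apply: le_trans (ler_normD _ _) _; rewrite normrM.
  apply: (@le_trans _ _ ((1 + `|g x|) * `|y - x|)).
    by rewrite mulrDl lerD2r hd'.
  by rewrite mulrC -ler_pdivlMr // ltW.
have := ler_wpM2l (normr_ge0 (y - x)) h2; lra.
Qed.

Lemma deriv01Z c f g : deriv01 f g ->
  deriv01 (fun x => c * f x) (fun x => c * g x).
Proof.
move=> fg x x01 e e0.
have c0 : 0 < `|c| + 1 by rewrite ltr_pwDr.
have [d d0 hd] := fg x x01 (e / (`|c| + 1)) (divr_gt0 e0 c0).
exists d => // y y01 yd.
have -> : c * f y - c * f x - c * g x * (y - x) = c * (f y - f x - g x * (y - x)) by ring.
rewrite normrM; apply: le_trans (ler_wpM2l (normr_ge0 _) (hd y y01 yd)) _.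
by rewrite mulrA ler_wpM2r // mulrCA ler_piMr ?(ltW e0) // ler_pdivrMr // mul1r lerDl.
Qed.

Lemma deriv01_eq f g h k : (forall x, 0 <= x <= 1 -> f x = h x) ->
  (forall x, 0 <= x <= 1 -> g x = k x) -> deriv01 f g -> deriv01 h k.
Proof.
move=> fh gk fg x x01 e e0; have [d d0 hd] := fg x x01 e e0.
by exists d => // y y01 yd; rewrite -!fh // -gk //; apply: hd.
Qed.

Lemma deriv01N f g : deriv01 f g -> deriv01 (fun x => - f x) (fun x => - g x).
Proof.
move=> /(deriv01Z (-1)); apply: deriv01_eq => x _; rewrite mulN1r //.
Qed.

(** Mean value inequality by real induction with slope [c + e]: the linearisation at [s] has slope
    at most [c], and [e] absorbs its error on both sides of [s]. As [y - x <= 1], the total loss is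
    at most [e]. *)
Lemma deriv01_le f g c x y : deriv01 f g -> 0 <= x -> x <= y -> y <= 1 ->
  (forall z, x <= z <= y -> g z <= c) -> f y - f x <= c * (y - x).
Proof.
move=> fg x0 xy y1 gc; rewrite -subr_le0; apply/ler_addgt0Pr => e e0; rewrite add0r.
suff : f y - f x <= (c + e) * (y - x).
  have : e * (y - x) <= e * 1 by rewrite ler_pM2l; lra.
  lra.
pose S z := f z - f x <= (c + e) * (z - x).
apply: (@real_induction R x y S) => //; first by rewrite /S; lra.
move=> s /andP[xs sy]; have [|d d0 hd] := fg s _ e e0; first by lra.
exists d => // z z' /andP[xz zs] /andP[sz' z'y] sdz z'sd.
rewrite /S => Sz.
have gs : g s <= c by apply: gc; rewrite xs.
have gsM w : 0 <= w -> g s * w <= c * w by move=> w0; rewrite ler_wpM2r.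
have h1 : f s - f z <= (c + e) * (s - z).
  have : 0 <= z <= 1 by lra.
  move=> /(hd z); rewrite ler0_norm ?ler_norml; last by lra.
  have /gsM : 0 <= s - z by lra.
  by move=> ? /(_ _)/andP[|? ?]; lra.
have h2 : f z' - f s <= (c + e) * (z' - s).
  have : 0 <= z' <= 1 by lra.
  move=> /(hd z'); rewrite [`|z' - s|]ger0_norm ?ler_norml; last by lra.
  have /gsM : 0 <= z' - s by lra.
  by move=> ? /(_ _)/andP[|? ?]; lra.
lra.
Qed.

Lemma deriv01_ge f g c x y : deriv01 f g -> 0 <= x -> x <= y -> y <= 1 ->
  (forall z, x <= z <= y -> c <= g z) -> c * (y - x) <= f y - f x.
Proof.
move=> fg x0 xy y1 cg.
have := @deriv01_le (fun z => - f z) (fun z => - g z) (- c) x y.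
move=> /(_ (deriv01N fg) x0 xy y1) -/(_ _)/wrap[z zxy|]; first by rewrite lerN2 cg.
lra.
Qed.

(** The bound on [g] is asked only at points no farther from [x] than [y], so that [C] may itself
    contain a factor [|y - x|], as in the second-order estimate below. *)
Lemma deriv01_lip f g C x y : deriv01 f g -> 0 <= x <= 1 -> 0 <= y <= 1 ->
  (forall z, 0 <= z <= 1 -> `|z - x| <= `|y - x| -> `|g z| <= C) ->
  `|f y - f x| <= C * `|y - x|.
Proof.
move=> fg x01 y01 gC.
have gCu z : 0 <= z <= 1 -> `|z - x| <= `|y - x| -> g z <= C.
  by move=> z01 zxy; have := gC z z01 zxy; rewrite ler_norml; lra.
have gCl z : 0 <= z <= 1 -> `|z - x| <= `|y - x| -> - C <= g z.
  by move=> z01 zxy; have := gC z z01 zxy; rewrite ler_norml; lra.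
have [xy|/ltW yx] := leP x y.
  rewrite [`|y - x|]ger0_norm; last lra.
  have le_xy z : x <= z <= y -> `|z - x| <= `|y - x|.
    by move=> zxy; rewrite !ger0_norm; lra.
  have u := @deriv01_le f g C x y fg; have l := @deriv01_ge f g (- C) x y fg.
  rewrite ler_norml; apply/andP; split.
    by rewrite -mulNr; apply: l => [|||z zxy]; try lra; apply: gCl; [lra|exact: le_xy].
  by apply: u => [|||z zxy]; try lra; apply: gCu; [lra|exact: le_xy].
rewrite distrC [`|y - x|]distrC [`|x - y|]ger0_norm; last lra.
have le_xy z : y <= z <= x -> `|z - x| <= `|y - x|.
  by move=> zxy; rewrite !ler0_norm; lra.
have u := @deriv01_le f g C y x fg; have l := @deriv01_ge f g (- C) y x fg.
rewrite ler_norml; apply/andP; split.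
  by rewrite -mulNr; apply: l => [|||z zxy]; try lra; apply: gCl; [lra|exact: le_xy].
by apply: u => [|||z zxy]; try lra; apply: gCu; [lra|exact: le_xy].
Qed.

Lemma deriv01_taylor2 f g k C x y : deriv01 f g -> deriv01 g k ->
  (forall z, 0 <= z <= 1 -> `|k z| <= C) -> 0 <= x <= 1 -> 0 <= y <= 1 ->
  `|f y - f x - g x * (y - x)| <= C * `|y - x| * `|y - x|.
Proof.
move=> fg gk kC x01 y01.
have C0 : 0 <= C by apply: le_trans (kC x x01); rewrite normr_ge0.
have df : deriv01 (fun z => f z + (- g x) * z) (fun z => g z + (- g x) * 1).
  by apply: deriv01D => //; apply: deriv01Z; exact: deriv01_id.
have -> : f y - f x - g x * (y - x) = (f y + (- g x) * y) - (f x + (- g x) * x).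
  by ring.
apply: (deriv01_lip df) => // z z01 zxy.
rewrite mulr1; apply: le_trans (deriv01_lip gk _ _ _) _ => //; first by auto.
by rewrite ler_wpM2l.
Qed.

Lemma deriv01_bounded f g : deriv01 f g ->
  exists B, forall x, 0 <= x <= 1 -> `|f x| <= B.
Proof.
move=> fg; pose S z := exists B, forall x, 0 <= x <= z -> `|f x| <= B.
apply: (@real_induction R 0 1 S) => //.
  by exists `|f 0| => x /andP[x0 x0']; have -> : x = 0 by lra.
move=> s s01; have [d d0 hd] := fg s s01 1 ltr01.
exists d => // z z' /andP[z0 zs] /andP[sz' z'1] sdz z'sd [B hB].
exists (Num.max B (`|f s| + `|g s| + 1)) => x /andP[x0 xz'].
rewrite le_max; have [xz|zx] := leP x z; first by rewrite hB ?x0.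
have xs1 : `|x - s| <= 1 by rewrite ler_norml; lra.
have xsd : `|x - s| < d by rewrite ltr_norml; lra.
have := hd x; rewrite x0 => /(_ _ xsd) -/(_ _)/wrap[|h]; first by lra.
apply/orP; right.
have -> : f x = f s + (f x - f s - g s * (x - s)) + g s * (x - s) by ring.
apply: le_trans (ler_normD _ _) _; apply: le_trans (lerD (ler_normD _ _) (lexx _)) _.
have : `|g s * (x - s)| <= `|g s| by rewrite normrM ler_piMr.
lra.
Qed.

Lemma deriv01_uniq f g h x : deriv01 f g -> deriv01 f h -> 0 <= x <= 1 ->
  g x = h x.
Proof.
move=> fg fh x01; apply/eqP; rewrite -subr_eq0 -normr_le0.
apply/ler_addgt0Pr => e e0; rewrite add0r.
have e20 : 0 < e / 2 by rewrite divr_gt0.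
have [d d0 hd] := fg x x01 _ e20; have [d' d'0 hd'] := fh x x01 _ e20.
have [y [y01 yd yd' yx]] : exists y, [/\ 0 <= y <= 1, `|y - x| < d, `|y - x| < d' & y != x].
  pose m := Num.min (Num.min d d' / 2) (1 / 2).
  have m0 : 0 < m by rewrite !lt_min !divr_gt0 ?lt_min ?d0 ?d'0.
  have md : m <= Num.min d d' / 2 by rewrite ge_min lexx.
  have [m1 m2 m3] : [/\ m < d, m < d' & m <= 1 / 2].
    have hd1 : Num.min d d' <= d by rewrite ge_min lexx.
    have hd2 : Num.min d d' <= d' by rewrite ge_min lexx orbT.
    have m3 : m <= 1 / 2 by rewrite ge_min lexx orbT.
    by split; lra.
  (* The test point lies on the side of [x] with at least 1/2 of room. *)
  have [x2|x2] := leP x (1 / 2).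
    exists (x + m); have -> : x + m - x = m by ring.
    by rewrite gtr0_norm //; split=> //; [lra|apply/eqP; lra].
  exists (x - m); have -> : x - m - x = - m by ring.
  by rewrite normrN gtr0_norm //; split=> //; [lra|apply/eqP; lra].
have yx0 : 0 < `|y - x| by rewrite normr_gt0 subr_eq0.
rewrite -(ler_pM2r yx0) -normrM.
have -> : (g x - h x) * (y - x) = (f y - f x - h x * (y - x)) - (f y - f x - g x * (y - x)).
  by ring.
apply: le_trans (ler_normB _ _) _.
have := hd y y01 yd; have := hd' y y01 yd'; lra.
Qed.

(** A common bound on the second derivatives makes the quadratic remainder estimate uniform in [N],
    so it survives the pointwise limit and no uniform convergence has to be proved. *)
Lemma deriv01_lim f g (fN gN kN : nat -> R -> R) C :
  (forall N, deriv01 (fN N) (gN N)) -> (forall N, deriv01 (gN N) (kN N)) ->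
  (forall N x, 0 <= x <= 1 -> `|kN N x| <= C) ->
  (forall x, 0 <= x <= 1 -> fN N x @[N --> \oo] --> f x) ->
  (forall x, 0 <= x <= 1 -> gN N x @[N --> \oo] --> g x) ->
  deriv01 f g.
Proof.
move=> df dg kC cf cg x x01 e e0.
have C0 : 0 <= C by apply: le_trans (kC 0%N x x01); rewrite normr_ge0.
have C10 : 0 < C + 1 by lra.
exists (e / (C + 1)); first by rewrite divr_gt0.
move=> y y01 yd.
have key : `|f y - f x - g x * (y - x)| <= C * `|y - x| * `|y - x|.
  have cv : `|fN N y - fN N x - gN N x * (y - x)| @[N --> \oo] -->
            `|f y - f x - g x * (y - x)|.
    apply: cvg_norm; apply: cvgB; first by apply: cvgB; apply: cf.
    by apply: cvgM; [apply: cg|apply: cvg_cst].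
  apply: (@cvgr_to_le _ _ _ _ _ _ _ cv); near=> N.
  exact: (deriv01_taylor2 (df N) (dg N) (kC N)).
apply: le_trans key _; rewrite ler_wpM2r //.
apply: le_trans (_ : C * (e / (C + 1)) <= _); first by rewrite ler_wpM2l // ltW.
rewrite mulrCA ler_piMr ?(ltW e0) // ler_pdivrMr //; lra.
Unshelve. all: by end_near.
Qed.

End Deriv01.

(** * Primitives prescribed by a binary word *)

Definition sgnb (R : realType) (b : bool) : R := if b then 1 else -1.

(* [f = T_b u], with [T_true u x = int_0^x u] and [T_false u x = int_x^1 u]. *)
Definition prim (R : realType) (b : bool) (f u : R -> R) :=
  deriv01 f (fun x => sgnb R b * u x) /\ if b then f 0 = 0 else f 1 = 0.

Definition tseq (R : realType) (Q : nat -> bool) (G : nat -> R -> R) :=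
  forall n, prim (Q n) (G n.+1) (G n).

Section Prim.
Variable R : realType.
Implicit Types (b : bool) (f g u v : R -> R) (a c x : R).

Lemma prim_eq b f g u v : (forall x, 0 <= x <= 1 -> f x = g x) ->
  (forall x, 0 <= x <= 1 -> u x = v x) -> prim b f u -> prim b g v.
Proof.
move=> fg uv [df f0]; split.
  by apply: deriv01_eq df => x x01; rewrite ?fg ?uv.
have i0 : 0 <= (0 : R) <= 1 by lra.
have i1 : 0 <= (1 : R) <= 1 by lra.
by case: b f0 {df}; rewrite -fg.
Qed.

Lemma prim_lin b f g u v a c : prim b f u -> prim b g v ->
  prim b (fun x => a * f x + c * g x) (fun x => a * u x + c * v x).
Proof.
move=> [df f0] [dg g0]; split.
  apply: deriv01_eq (deriv01D (deriv01Z a df) (deriv01Z c dg)) => // x _.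
  by rewrite mulrDr !(mulrCA (sgnb R b)).
by case: b f0 g0 {df dg} => -> ->; rewrite !mulr0 addr0.
Qed.

Lemma primZ b f u a : prim b f u -> prim b (fun x => a * f x) (fun x => a * u x).
Proof.
move=> fu; apply: prim_eq (prim_lin a 0 fu fu) => x _; by rewrite mul0r addr0.
Qed.

Lemma prim_ge0 b f u : prim b f u -> (forall x, 0 <= x <= 1 -> 0 <= u x) ->
  forall x, 0 <= x <= 1 -> 0 <= f x.
Proof.
move=> [df f0] u0 x /andP[x0 x1]; case: b f0 df => f0 df.
  have := @deriv01_ge _ _ _ 0 0 x df (lexx _) x0 x1.
  rewrite f0 mul0r subr0; apply => z zx; rewrite mul1r u0 //; lra.
have := @deriv01_le _ _ _ 0 x 1 df x0 x1 (lexx _).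
rewrite f0 mul0r sub0r oppr_le0; apply => z zx; rewrite mulN1r oppr_le0 u0 //; lra.
Qed.

Lemma prim_le b f g u v : prim b f u -> prim b g v ->
  (forall x, 0 <= x <= 1 -> u x <= v x) ->
  forall x, 0 <= x <= 1 -> f x <= g x.
Proof.
move=> fu gv uv x x01; rewrite -subr_ge0.
have /prim_ge0 := prim_lin 1 (-1) gv fu.
move=> /(_ _ x x01)-/(_ _)/wrap[y y01|]; first by have := uv y y01; lra.
lra.
Qed.

Lemma prim_eq0 b f u : prim b f u -> (forall x, 0 <= x <= 1 -> f x = 0) ->
  forall x, 0 <= x <= 1 -> u x = 0.
Proof.
move=> [df _] f0 x x01.
have d0 : deriv01 f (fun=> 0) by apply: deriv01_eq (deriv01_cst 0) => // y /f0.
have := deriv01_uniq df d0 x01; rewrite /sgnb; case: b {df} => ?; lra.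
Qed.

Lemma deriv01_expn n : deriv01 (fun x : R => x ^+ n.+1) (fun x => n.+1%:R * x ^+ n).
Proof.
elim: n => [|n IHn].
  by apply: deriv01_eq (@deriv01_id R) => x _; rewrite ?expr1 // expr0 mulr1.
apply: deriv01_eq (deriv01_mulx IHn) => x _; first by rewrite -exprS.
by rewrite mulrCA -exprS -[X in X + _]mul1r -mulrDl nat1r.
Qed.

Lemma prim_expn n : prim true (fun x : R => x ^+ n.+1 / n.+1`!%:R)
                              (fun x => x ^+ n / n`!%:R).
Proof.
split; last by rewrite expr0n mul0r.
apply: deriv01_eq (deriv01Z (n.+1`!%:R^-1) (@deriv01_expn n)) => x _.
  by rewrite mulrC.
have f0 : n`!%:R != 0 :> R by rewrite pnatr_eq0 -lt0n fact_gt0.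
have n0 : n.+1%:R != 0 :> R by rewrite pnatr_eq0.
by rewrite mul1r factS natrM; move: n`! (n.+1%:R : R) f0 n0 => k y f0 n0; field; rewrite f0.
Qed.

(** T_0 u + T_1 u is the constant int_0^1 u. *)
Lemma prim_compl b f u : prim b f u ->
  prim (~~ b) (fun x => f (if b then 1 else 0) - f x) u.
Proof.
move=> [df f0]; split; last by case: b {df f0}; rewrite subrr.
apply: deriv01_eq (deriv01D (deriv01_cst (f (if b then 1 else 0))) (deriv01N df)) => //.
by move=> x _; rewrite add0r; case: b {df f0}; rewrite /= /sgnb /=; ring.
Qed.

(** The slope of [f] is at least [u x] before [x] and at most [u x] after it; weighting the two
    estimates by [1 - x] and [x] cancels [u x]. *)
Lemma prim_concave f u : prim true f u ->
  (forall x y, 0 <= x -> x <= y -> y <= 1 -> u y <= u x) ->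
  forall x, 0 <= x <= 1 -> f 1 * x <= f x.
Proof.
move=> [df f0] ud x /andP[x0 x1].
have h1 : u x * x <= f x.
  have := @deriv01_ge _ _ _ (u x) 0 x df (lexx _) x0 x1.
  rewrite f0 !subr0; apply => z /andP[z0 zx]; rewrite mul1r; exact: ud.
have h2 : f 1 - f x <= u x * (1 - x).
  apply: (@deriv01_le _ _ _ (u x) x 1 df x0 x1 (lexx _)) => z /andP[xz z1].
  by rewrite mul1r; exact: ud.
have h3 := ler_wpM2r x0 h2.
have h4 : u x * x * (1 - x) <= f x * (1 - x) by apply: ler_wpM2r => //; lra.
lra.
Qed.

End Prim.

Section TSeq.
Variables (R : realType) (Q : nat -> bool).
Implicit Types (G H : nat -> R -> R) (a b c x : R) (n : nat).

Lemma tseq_lin G H a b : tseq Q G -> tseq Q H ->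
  tseq Q (fun n x => a * G n x + b * H n x).
Proof. by move=> tG tH n; exact: prim_lin. Qed.

Lemma tseq_shift G k : (forall n, Q (n + k)%N = Q n) -> tseq Q G ->
  tseq Q (fun n => G (n + k)%N).
Proof. by move=> per tG n; rewrite -per; exact: tG. Qed.

Lemma tseq_ge0 G n k : tseq Q G -> (n <= k)%N ->
  (forall x, 0 <= x <= 1 -> 0 <= G n x) -> forall x, 0 <= x <= 1 -> 0 <= G k x.
Proof.
move=> tG /subnKC <- G0; elim: (k - n)%N => [|i IHi]; first by rewrite addn0.
by rewrite addnS; exact: prim_ge0 (tG _) IHi.
Qed.

Lemma tseq_le G H n k a b : tseq Q G -> tseq Q H -> (n <= k)%N ->
  (forall x, 0 <= x <= 1 -> a * G n x <= b * H n x) ->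
  forall x, 0 <= x <= 1 -> a * G k x <= b * H k x.
Proof.
move=> tG tH nk GH x x01.
have /tseq_ge0 := tseq_lin (- a) b tG tH.
move=> /(_ n k nk)-/(_ _)/wrap[y y01|/(_ x x01)].
  by have := GH y y01; lra.
lra.
Qed.

Lemma tseq_neq0 G n k : tseq Q G -> (n <= k)%N ->
  (exists2 x, 0 <= x <= 1 & G n x != 0) -> exists2 x, 0 <= x <= 1 & G k x != 0.
Proof.
move=> tG /subnKC <- G0; elim: (k - n)%N => [|i [x x01 /eqP Gx]]; first by rewrite addn0.
rewrite addnS; apply: contrapT => /forall2NP h; apply: Gx.
apply: (prim_eq0 (tG _)) x01 => y y01.
by have [//|/negP] := h y; rewrite negbK => /eqP.
Qed.

(* After the first 0 the function is decreasing, after the next 1 it is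
   concave and vanishes at 0, hence lies between [al * x] and [al]; the
   remaining operators preserve such two-sided bounds. *)
Lemma tseq_harnack (s a : nat) : Q s = false -> (forall i, (i <= a)%N -> Q (s + i.+1)%N) ->
  Q (s + a.+2)%N = false ->
  exists2 c : R, 0 < c <= 1 & forall G, tseq Q G ->
    (forall x, 0 <= x <= 1 -> 0 <= G s x) ->
    exists2 al, 0 <= al & forall x, 0 <= x <= 1 ->
      c * al * (1 - x) <= G (s + a.+3)%N x <= al * (1 - x).
Proof.
(* After the first 1 the lower bound is [al * x]. The other [a] ones turn it into al x^(a+1) /
   (a+1)!, and the closing 0 into al (1 - x^(a+2)) / (a+2)!, which is at least al (1 - x) /
   (a+2)!. *)
move=> Qs Qi Qa; exists ((a.+2)`!%:R^-1).
  by rewrite invr_gt0 ltr0n fact_gt0 /= invf_le1 ?ltr0n ?fact_gt0 // ler1n fact_gt0.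
move=> G tG G0.
have i1 : 0 <= (1 : R) <= 1 by lra.
have f1 : 1`! = 1%N by [].
pose al := G (s + 2)%N 1.
have G10 := @tseq_ge0 G s (s + 1) tG (leq_addr _ _) G0.
have G20 := @tseq_ge0 G s (s + 2) tG (leq_addr _ _) G0.
have al0 : 0 <= al by exact: G20.
have G1 : prim true (G (s + 2)%N) (G (s + 1)%N).
  by have := tG (s + 1)%N; rewrite Qi // -addnS.
have G2lo : forall x, 0 <= x <= 1 -> al * x <= G (s + 2)%N x.
  apply: (prim_concave G1) => x y x0 xy y1.
  have := tG s; rewrite Qs => -[dG _]; rewrite addn1 -subr_le0.
  rewrite -[leRHS](mul0r (y - x)).
  apply: (deriv01_le dG x0 xy y1) => z zxy; rewrite mulN1r oppr_le0 G0 //; lra.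
have G2up : forall x, 0 <= x <= 1 -> G (s + 2)%N x <= al.
  move=> x /andP[x0 x1]; rewrite -subr_ge0 -[leLHS](mul0r (1 - x)).
  by apply: (deriv01_ge G1.1 x0 x1 (lexx _)) => z zxy; rewrite mul1r G10 //; lra.
have GI i : (i <= a)%N -> forall x, 0 <= x <= 1 ->
    al * (x ^+ i.+1 / i.+1`!%:R) <= G (s + i.+2)%N x /\ G (s + i.+2)%N x <= al.
  elim: i => [_ x x01|i IHi ia x x01].
    by rewrite f1 expr1 divr1 G2lo // G2up.
  have {}IHi := IHi (ltnW ia).
  have pG := tG (s + i.+2)%N; rewrite Qi // -addnS in pG.
  split; first by apply: prim_le (primZ al (prim_expn R i.+1)) pG _ x x01 => y /IHi[].
  apply: (@le_trans _ _ (al * (x ^+ 1 / 1`!%:R))).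
    apply: prim_le pG (primZ al (prim_expn R 0)) _ x x01 => y /IHi[_].
    by rewrite fact0 expr0 divr1 mulr1.
  by rewrite f1 expr1 divr1 ler_piMr //; lra.
have pG := tG (s + a.+2)%N; rewrite Qa -addnS in pG.
have p0 := primZ al (prim_compl (prim_expn R 0)).
have p1 := primZ al (prim_compl (prim_expn R a.+1)).
exists al => // x x01; apply/andP; split.
  apply: (@le_trans _ _ (al * (1 ^+ a.+2 / a.+2`!%:R - x ^+ a.+2 / a.+2`!%:R))).
    rewrite expr1n -mulrBl [_ * al]mulrC -mulrA ler_wpM2l // mulrC ler_wpM2r ?invr_ge0 //.
    by rewrite lerB // exprS ler_piMr ?exprn_ile1 //; lra.
  by apply: prim_le p1 pG _ x x01 => y /(GI a (leqnn _))[].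
apply: le_trans (prim_le pG p0 _ x01) _.
  by move=> y /(GI a (leqnn _))[_]; rewrite fact0 expr0 divr1 mulr1.
by rewrite f1 !expr1 !divr1.
Qed.

End TSeq.

(** * Perturbations of a constant sequence *)

(** The contraction gains a factor [q] once per [M] indices, so each block of [M] indices
    contributes one term of a geometric series [M] times. *)
Lemma sum_expr_divn_le (R : realType) (q : R) (M n : nat) : 0 <= q < 1 ->
  (0 < M)%N -> \sum_(k < n) q ^+ (k %/ M) <= M%:R / (1 - q).
Proof.
move=> /andP[q0 q1] M0.
have blocks j : \sum_(0 <= k < M * j) q ^+ (k %/ M) = M%:R * \sum_(i < j) q ^+ i.
  elim: j => [|j IHj]; first by rewrite muln0 big_geq // big_ord0 mulr0.
  rewrite mulnS addnC (big_cat_nat (n := (M * j)%N)) ?leq_addr //= IHj.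
  rewrite big_ord_recr /= mulrDr; congr (_ + _).
  rewrite -{1}[(M * j)%N]add0n big_addn addKn.
  rewrite (eq_big_nat _ _ (F2 := fun=> q ^+ j)); last first.
    by move=> i /andP[_ iM]; rewrite addnC mulnC divnMDl // divn_small // addn0.
  by rewrite big_const_nat subn0 iter_addr_0 mulr_natl.
apply: (@le_trans _ _ (\sum_(0 <= k < M * n) q ^+ (k %/ M))).
  rewrite -(big_mkord xpredT (fun k => q ^+ (k %/ M))).
  rewrite (big_cat_nat (n := n) (p := (M * n)%N)) ?leq_pmull //=.
  by rewrite lerDl sumr_ge0 // => i _; rewrite exprn_ge0.
rewrite blocks ler_wpM2l // -[leRHS]mul1r ler_pdivlMr ?subr_gt0 // mulrC.
have -> : (1 - q) * \sum_(i < n) q ^+ i = 1 - q ^+ n.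
  by rewrite -opprB mulNr -subrX1 opprB.
by rewrite gerBl exprn_ge0.
Qed.

Section PerturbedConstant.
Variables (R : realType) (d x : nat -> R) (S : R).
Hypothesis d_ge0 : forall k, 0 <= d k.
Hypothesis d_sum : forall n, \sum_(k < n) d k <= S.
Hypothesis x_ge0 : forall k, 0 <= x k.
Hypothesis x_step : forall k, `|x k.+1 - x k| <= d k * x k.

Lemma perturbed_le k : x k <= expR S * x 0%N.
Proof.
suff h : x k <= expR (\sum_(i < k) d i) * x 0%N.
  by apply: le_trans h _; rewrite ler_wpM2r // ler_expR.
elim: k => [|k IHk]; first by rewrite big_ord0 expR0 mul1r.
rewrite big_ord_recr /= addrC expRD -mulrA.
apply: (@le_trans _ _ ((1 + d k) * x k)).
  by have := x_step k; rewrite ler_norml; lra.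
by apply: ler_pM => //; [rewrite addr_ge0 | rewrite expR_ge1Dx].
Qed.

(** Since [x] is bounded, the relative bound on the increments makes them absolutely summable. *)
Lemma perturbed_cvg : cvgn x.
Proof.
have cd : cvgn (series d).
  apply: nondecreasing_is_cvgn; first by apply: nondecreasing_series => n _ _.
  by exists S => _ [n _ <-]; rewrite /series /= big_mkord.
have cx : cvgn (series (telescope x)).
  apply: normed_cvg; apply: (@series_le_cvg _ _ (fun k => expR S * x 0%N * d k)).
  - by move=> k; rewrite normr_ge0.
  - by move=> k; rewrite !mulr_ge0 // expR_ge0.
  - move=> k; apply: le_trans (x_step k) _; rewrite mulrC ler_wpM2r //.
    exact: perturbed_le.
  have -> : series (fun k => expR S * x 0%N * d k) = (fun n => expR S * x 0%N * series d n).
    by apply/funext => n; rewrite /series /= mulr_sumr.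
  by apply: is_cvgMr => //; exact: is_cvg_cst.
have -> : x = (fun n => x 0%N + series (telescope x) n).
  by apply/funext => n; rewrite -eq_sum_telescope.
by apply: is_cvgD => //; exact: is_cvg_cst.
Qed.

(** Once d <= 1/2, (1 - d)(1 + 2d) >= 1 gives 1 - d >= exp(-2d), so from that index on [x] loses at
    most the factor exp(-2S). *)
Lemma perturbed_gt0 : (forall k, 0 < x k) -> d @ \oo --> 0 -> 0 < limn x.
Proof.
move=> x_gt0 d0.
have [K _ hK] : \forall k \near \oo, d k <= 1 / 2.
  have half : 0 < 1 / 2 :> R by rewrite divr_gt0.
  move/cvgrPdist_le: d0 => /(_ _ half).
  by apply: filterS => k; rewrite sub0r normrN ger0_norm.
have lb k : expR (- (2 * \sum_(i < k) d (K + i)%N)) * x K <= x (K + k)%N.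
  elim: k => [|k IHk]; first by rewrite big_ord0 mulr0 oppr0 expR0 mul1r addn0.
  have dk : d (K + k)%N <= 1 / 2 by apply: hK; rewrite /= leq_addr.
  rewrite big_ord_recr /= mulrDr opprD addrC expRD -mulrA addnS.
  apply: le_trans (ler_wpM2l (expR_ge0 _) IHk) _.
  rewrite expRN mulrC ler_pdivrMr ?expR_gt0 //.
  apply: (@le_trans _ _ (x (K + k).+1 * (1 + 2 * d (K + k)%N))); last first.
    by rewrite ler_wpM2l // expR_ge1Dx.
  have := x_step (K + k)%N; rewrite ler_norml => /andP[h _].
  have {}h : (1 - d (K + k)%N) * x (K + k)%N <= x (K + k).+1 by lra.
  have dk0 : 0 <= 1 + 2 * d (K + k)%N by have := d_ge0 (K + k); lra.
  apply: le_trans (ler_wpM2r dk0 h); rewrite mulrAC ler_peMl //.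
  have := d_ge0 (K + k); nra.
apply: (@lt_le_trans _ _ (expR (- (2 * S)) * x K)).
  by rewrite mulr_gt0 // expR_gt0.
apply: limr_ge; first exact: perturbed_cvg.
exists K => // n /= Kn; rewrite -(subnKC Kn); apply: le_trans (lb _).
rewrite ler_wpM2r // ler_expR lerN2 ler_wpM2l //.
apply: le_trans (d_sum (K + (n - K))).
rewrite big_split_ord /= lerDr sumr_ge0 //.
Qed.

End PerturbedConstant.

(** * Contraction of ratios *)

Section Perron.
Variables (R : realType) (m : nat) (Q : nat -> bool).
Hypothesis m_gt0 : (0 < m)%N.
Hypothesis Q_per : forall n, Q (n + m)%N = Q n.
Hypothesis Q_last : Q m.-1 = false.
Hypothesis Q_one : exists i, Q i.
Implicit Types (G H g : nat -> R -> R) (a b c x : R) (n : nat).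

Lemma period_mul n k : Q (n + k * m)%N = Q n.
Proof. by elim: k => [|k IHk]; rewrite ?addn0 // mulSnr addnA Q_per. Qed.

(** Starting from the 0 that ends the period, the letter before the first following 1 is a 0, and by
    periodicity a further 0 comes after that 1. The block may straddle two periods. *)
Lemma zero_ones_zero : exists s t, [/\ Q s = false,
  forall i, (i <= t)%N -> Q (s + i.+1)%N & Q (s + t.+2)%N = false].
Proof.
have [i0 Qi0] := Q_one.
have ex1 : exists i, Q (m.-1 + i)%N.
  exists i0.+1; have -> : (m.-1 + i0.+1 = i0 + 1 * m)%N by lia.
  by rewrite period_mul.
case: (ex_minnP ex1) => i Qi mini.
have i_gt0 : (0 < i)%N by case: i Qi {mini} => //; rewrite addn0 Q_last.
have ex0 : exists j, ~~ Q (m.-1 + i + j)%N.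
  exists (i * m - i)%N.
  have -> : (m.-1 + i + (i * m - i) = m.-1 + i * m)%N by rewrite -addnA subnKC // leq_pmulr.
  by rewrite period_mul Q_last.
case: (ex_minnP ex0) => j Qj minj.
have j_gt0 : (0 < j)%N by case: j Qj {minj} => //; rewrite addn0 Qi.
exists (m.-1 + i.-1)%N, j.-1; split.
- by apply/negP => /mini; lia.
- move=> k kj; apply: contraT => nQ.
  have := minj k; have -> : (m.-1 + i + k = m.-1 + i.-1 + k.+1)%N by lia.
  by move=> /(_ nQ); lia.
- have -> : (m.-1 + i.-1 + j.-1.+2 = m.-1 + i + j)%N by lia.
  exact: negbTE.
Qed.

(* [D = G - a g] and [E = b g - G] add up to [(b - a) g]; the Harnack bound
   makes the larger of the two at least a fixed fraction of their sum. *)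
Lemma tseq_contract : exists M (q : R), [/\ (0 < M)%N, 0 <= q < 1,
  forall n, Q (n + M)%N = Q n &
  forall g G a b, tseq Q g -> tseq Q G ->
    (forall x, 0 <= x <= 1 -> 0 <= g 0%N x) ->
    (forall x, 0 <= x <= 1 -> a * g 0%N x <= G 0%N x <= b * g 0%N x) -> a <= b ->
    exists a' b', [/\ a <= a', a' <= b', b' <= b, b' - a' <= q * (b - a) &
      forall x, 0 <= x <= 1 -> a' * g M x <= G M x <= b' * g M x]].
Proof.
have [s [t [Qs Qi Qt]]] := zero_ones_zero.
have [c /andP[c0 c1] harnack] := @tseq_harnack R Q s t Qs Qi Qt.
(* [N] is the time at which the block ends; [M] is a later time that is a multiple of the period, so
   the contraction can be iterated from there. *)
pose N := (s + t.+3)%N; pose M := (N * m)%N.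
have NM : (N <= M)%N by rewrite leq_pmulr.
(* If [v <= u], then at time [N] one has (b - a) g <= (u + v)(1 - x) <= 2u(1 - x), while D >= c u (1
   - x). Hence D >= (c / 2)(b - a) g, which raises [a] by that fraction of the gap. *)
exists M, (1 - c / 2); split.
- by rewrite /M muln_gt0 m_gt0 /N; lia.
- by apply/andP; split; lra.
- by move=> n; exact: period_mul.
move=> g G a b tg tG g0 ab le_ab.
have tD := tseq_lin 1 (- a) tG tg; have tE := tseq_lin (-1) b tG tg.
have D0 x : 0 <= x <= 1 -> 0 <= 1 * G 0%N x + - a * g 0%N x.
  by move=> /ab/andP[]; lra.
have E0 x : 0 <= x <= 1 -> 0 <= -1 * G 0%N x + b * g 0%N x.
  by move=> /ab/andP[]; lra.
have [u u0 hu] := harnack _ tD (tseq_ge0 tD (leq0n s) D0).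
have [v v0 hv] := harnack _ tE (tseq_ge0 tE (leq0n s) E0).
have lo := tseq_le tg tG (leq0n M) (a := a) (b := 1).
have up := tseq_le tG tg (leq0n M) (a := 1) (b := b).
have loM x : 0 <= x <= 1 -> a * g M x <= G M x.
  by move=> x01; rewrite -[G M x]mul1r; apply: lo x01 => y /ab; rewrite mul1r => /andP[].
have upM x : 0 <= x <= 1 -> G M x <= b * g M x.
  by move=> x01; rewrite -[G M x]mul1r; apply: up x01 => y /ab; rewrite mul1r => /andP[].
have cba : 0 <= c * (b - a) by rewrite mulr_ge0 ?subr_ge0 // ltW.
have cba1 : c * (b - a) <= b - a by rewrite ler_piMl // subr_ge0.
have [vu|/ltW uv] := leP v u.
  exists (a + c / 2 * (b - a)), b; split; try lra.
  move=> x x01; rewrite upM // andbT -[G M x]mul1r.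
  apply: (tseq_le tg tG NM _ x01) => y y01.
  have /andP[u1 u2] := hu y y01; have /andP[v1 v2] := hv y y01.
  have y1 : 0 <= 1 - y by lra.
  have uvy : c * v * (1 - y) <= c * u * (1 - y).
    by apply: ler_wpM2r => //; apply: ler_wpM2l => //; lra.
  have := ler_wpM2l (ltW c0) (lerD u2 v2).
  rewrite -/N in u1 u2 v1 v2 *; lra.
exists a, (b - c / 2 * (b - a)); split; try lra.
move=> x x01; rewrite loM //= -[G M x]mul1r.
apply: (tseq_le tG tg NM _ x01) => y y01.
have /andP[u1 u2] := hu y y01; have /andP[v1 v2] := hv y y01.
have y1 : 0 <= 1 - y by lra.
have uvy : c * u * (1 - y) <= c * v * (1 - y).
  by apply: ler_wpM2r => //; apply: ler_wpM2l => //; lra.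
have := ler_wpM2l (ltW c0) (lerD u2 v2).
rewrite -/N in u1 u2 v1 v2 *; lra.
Qed.

(** The nested intervals of ratio bounds at times [k * M] shrink to one constant [c]. The last
    clause, that a lower ratio bound at any time stays below [c], is what later shows the growth
    rate to be positive. *)
Lemma tseq_ratio : exists M (q : R), [/\ (0 < M)%N, 0 <= q < 1 &
  forall g G a b, tseq Q g -> tseq Q G ->
    (forall x, 0 <= x <= 1 -> 0 <= g 0%N x) ->
    (forall n, exists2 x, 0 <= x <= 1 & g n x != 0) ->
    (forall x, 0 <= x <= 1 -> a * g 0%N x <= G 0%N x <= b * g 0%N x) -> a <= b ->
    exists c, (forall n x, 0 <= x <= 1 ->
                 `|G n x - c * g n x| <= q ^+ (n %/ M) * (b - a) * g n x) /\
      forall n a', (forall x, 0 <= x <= 1 -> a' * g n x <= G n x) -> a' <= c].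
Proof.
have [M [q [M0 q01 QM contract]]] := tseq_contract.
exists M, q; split => // g G a b tg tG g0 gn ab le_ab.
have unit_start_ge0 n : forall x, 0 <= x <= 1 -> 0 <= g n x by exact: tseq_ge0 g0.
have nest k : exists a' b', [/\ a' <= b', b' - a' <= q ^+ k * (b - a) &
    forall x, 0 <= x <= 1 -> a' * g (k * M)%N x <= G (k * M)%N x <= b' * g (k * M)%N x].
  elim: k => [|k [a' [b' [le' len' ab']]]]; first by exists a, b; rewrite expr0 mul1r.
  have per n : Q (n + k * M)%N = Q n.
    by elim: k {le' len' ab'} => [|k IHk]; rewrite ?addn0 // mulSnr addnA QM.
  have [] := contract _ _ a' b' (tseq_shift per tg) (tseq_shift per tG) _ _ le'.
  - by move=> x; exact: unit_start_ge0.
  - by move=> x; exact: ab'.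
  move=> a2 [b2 [_ le2 _ len2 ab2]]; exists a2, b2; split => //.
  rewrite exprS -mulrA; apply: le_trans len2 _.
  by apply: ler_wpM2l => //; case/andP: q01.
(* [c] is the supremum of the lower bounds over all times. An upper bound at any time dominates
   them: both are carried to the later of the two times, where [g] is nonzero somewhere. *)
pose A := [set a' | exists n, forall x, 0 <= x <= 1 -> a' * g n x <= G n x].
have A_ub n b' : (forall x, 0 <= x <= 1 -> G n x <= b' * g n x) -> ubound A b'.
  move=> hb a' [n' ha].
  have [x x01 gx] := gn (maxn n n').
  have gx0 : 0 < g (maxn n n') x by rewrite lt0r gx unit_start_ge0.
  rewrite -(ler_pM2r gx0).
  have := @tseq_le R Q g G n' (maxn n n') a' 1 tg tG (leq_maxr _ _).
  move=> /(_ _ x x01)-/(_ _)/wrap[y y01|]; first by rewrite mul1r ha.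
  have := @tseq_le R Q G g n (maxn n n') 1 b' tG tg (leq_maxl _ _).
  move=> /(_ _ x x01)-/(_ _)/wrap[y y01|]; first by rewrite mul1r hb.
  lra.
have A0 : A !=set0 by exists a, 0%N => x /ab/andP[].
have supA : has_sup A.
  by split => //; exists b; apply: (A_ub 0%N) => x /ab/andP[].
exists (sup A); split => [n x x01|n a' ha']; last first.
  by apply: ub_le_sup; [case: supA | exists n].
have [a' [b' [le' len' ab']]] := nest (n %/ M)%N.
have a'c : a' <= sup A.
  by apply: ub_le_sup; [case: supA | exists (n %/ M * M)%N => y /ab'/andP[]].
have cb' : sup A <= b'.
  by apply: ge_sup => //; apply: (A_ub (n %/ M * M)%N) => y /ab'/andP[].
have lo : a' * g n x <= 1 * G n x.
  by apply: (tseq_le tg tG (leq_trunc_div n M) _ x01) => y /ab'/andP[]; rewrite mul1r.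
have up : 1 * G n x <= b' * g n x.
  by apply: (tseq_le tG tg (leq_trunc_div n M) _ x01) => y /ab'/andP[]; rewrite mul1r.
have gx := unit_start_ge0 n x x01.
have := ler_wpM2r gx len'; have := ler_wpM2r gx a'c; have := ler_wpM2r gx cb'.
by rewrite ler_norml; lra.
Qed.

End Perron.

(** * The limit profile *)

Section PerronLimit.
Variables (R : realType) (m : nat) (Q : nat -> bool) (g : nat -> R -> R).
Hypothesis m_gt0 : (0 < m)%N.
Hypothesis Q_per : forall n, Q (n + m)%N = Q n.
Hypothesis Q_last : Q m.-1 = false.
Hypothesis Q_one : exists i, Q i.
Hypothesis tg : tseq Q g.
Hypothesis g0 : forall x, 0 <= x <= 1 -> g 0%N x = 1.

Lemma unit_start_ge0 n x : 0 <= x <= 1 -> 0 <= g n x.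
Proof. by apply: tseq_ge0 tg (leq0n n) _ x => y /g0 ->. Qed.

Lemma unit_start_neq0 n : exists2 x, 0 <= x <= 1 & g n x != 0.
Proof.
apply: (tseq_neq0 tg (leq0n n)).
by exists 0; rewrite ?g0 ?oner_neq0 // lexx ler01.
Qed.

Lemma unit_start_le1 n x : 0 <= x <= 1 -> g n x <= 1.
Proof.
elim: n x => [x /g0 -> //|n IHn x x01].
have [dg bc] := tg n.
have gn z : 0 <= z <= 1 -> `|sgnb R (Q n) * g n z| <= 1.
  move=> z01; rewrite normrM (ger0_norm (unit_start_ge0 n z01)).
  by rewrite /sgnb; case: (Q n); rewrite ?normrN1 ?normr1 mul1r IHn.
have lip y : 0 <= y <= 1 -> `|g n.+1 x - g n.+1 y| <= 1 * `|x - y|.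
  by move=> y01; apply: (deriv01_lip dg) => // z z01 _; exact: gn.
have i0 : 0 <= (0 : R) <= 1 by lra.
have i1 : 0 <= (1 : R) <= 1 by lra.
case: (Q n) bc => bc.
  by have := lip 0 i0; rewrite bc !subr0 !ger0_norm ?unit_start_ge0 //; lra.
have := lip 1 i1; rewrite bc subr0 ger0_norm ?unit_start_ge0 // ler0_norm; lra.
Qed.

Lemma unit_start_dom G C : tseq Q G -> (forall x, 0 <= x <= 1 -> `|G 0%N x| <= C) ->
  forall n x, 0 <= x <= 1 -> `|G n x| <= C * g n x.
Proof.
move=> tG GC n x x01; rewrite ler_norml.
have lo : - C * g n x <= 1 * G n x.
  apply: (tseq_le tg tG (leq0n n) _ x01) => y y01.
  by have := GC y y01; rewrite g0 // ler_norml; lra.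
have up : 1 * G n x <= C * g n x.
  apply: (tseq_le tG tg (leq0n n) _ x01) => y y01.
  by have := GC y y01; rewrite g0 // ler_norml; lra.
lra.
Qed.

(** Contraction of [g] against its shift by one period gives [gam], with error relative to [g]
    itself. Thus, for fixed [n] and [x], the values rescaled by [gam ^+ k] form a perturbed constant
    sequence, whose limit is [F n x]. *)
Lemma perron : exists gam F,
  [/\ 0 < gam,
    tseq Q F /\ forall n x, 0 <= x <= 1 -> F (n + m)%N x = gam * F n x,
    (forall n x, 0 <= x <= 1 -> g (m * k + n)%N x / gam ^+ k @[k --> \oo] --> F n x)
      /\ (exists B, forall k n x, 0 <= x <= 1 -> g (m * k + n)%N x <= B * gam ^+ k),
    forall n, exists2 x, 0 <= x <= 1 & F n x != 0 &
    forall G, tseq Q G -> (exists C, forall x, 0 <= x <= 1 -> `|G 0%N x| <= C) ->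
      (forall n x, 0 <= x <= 1 -> G (n + m)%N x = gam * G n x) ->
      exists c, forall n x, 0 <= x <= 1 -> G n x = c * F n x].
Proof.
have [M [q [M0 /andP[q0 q1] ratio]]] := @tseq_ratio R m Q m_gt0 Q_per Q_last Q_one.
have g00 x : 0 <= x <= 1 -> 0 <= g 0%N x by exact: unit_start_ge0.
(* The initial ratio bounds 0 and 1 come from 0 <= g_m <= 1 = g_0. *)
have [gam []] := ratio g (fun n => g (n + m)%N) 0 1 tg (tseq_shift Q_per tg) g00 unit_start_neq0
  (fun x x01 => ltac:(by rewrite mul0r mul1r g0 // unit_start_ge0 // unit_start_le1)) ler01.
rewrite subr0 => near_gam max_gam.
have [s [t [Qs Qi Qt]]] := @zero_ones_zero m Q m_gt0 Q_per Q_last Q_one.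
have [c /andP[c0 c1] harnack] := @tseq_harnack R Q s t Qs Qi Qt.
pose N := (s + t.+3)%N.
have perk k n : Q (n + m * k)%N = Q n by rewrite mulnC (period_mul Q_per).
have perk' k n : Q (m * k + n)%N = Q n by rewrite addnC perk.
have i0 : 0 <= (0 : R) <= 1 by lra.
have harnack_k k : exists2 al, 0 < al &
    forall x, 0 <= x <= 1 -> c * al * (1 - x) <= g (N + m * k)%N x <= al * (1 - x).
  have [al al0 hal] := harnack _ (tseq_shift (perk k) tg) (fun x => @unit_start_ge0 _ x).
  exists al => //; rewrite lt0r al0 andbT; apply/eqP => al_eq0.
  have [x x01 /eqP gx] := unit_start_neq0 (N + m * k); apply: gx.
  have := hal x x01; rewrite al_eq0 mulr0 mul0r -/N; lra.
(* The Harnack profiles at times [N] and [N + m] compare to give the positive lower ratio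
   [c * v / u]. *)
have gam_gt0 : 0 < gam.
  have [u u0 hu] := harnack_k 0%N; have [v v0 hv] := harnack_k 1%N.
  apply: (@lt_le_trans _ _ (c * v / u)); first by rewrite !mulr_gt0 ?invr_gt0.
  apply: (max_gam N) => x x01; have := hu x x01; have := hv x x01.
  rewrite muln0 addn0 muln1 => /andP[hv1 _] /andP[_ hu2].
  apply: le_trans hv1; have -> : c * v * (1 - x) = c * v / u * (u * (1 - x)).
    by field; rewrite gt_eqF.
  by apply: ler_wpM2l => //; rewrite !mulr_ge0 ?invr_ge0 // ltW.
pose d k := q ^+ (k %/ M) / gam.
have d_ge0 k : 0 <= d k by rewrite mulr_ge0 ?exprn_ge0 // invr_ge0 ltW.
have d_sum n : \sum_(k < n) d k <= M%:R / (1 - q) / gam.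
  rewrite -mulr_suml ler_wpM2r ?invr_ge0 ?(ltW gam_gt0) //.
  by apply: sum_expr_divn_le; rewrite ?q0.
have qk0 : q ^+ (k %/ M) @[k --> \oo] --> 0.
  have q_lt1 : `|q| < 1 by rewrite ger0_norm.
  apply: (cvg_comp _ _ _ (cvg_expr q_lt1)); apply/cvgnyPge => n.
  by exists (n * M)%N => // k /=; rewrite leq_divRL.
have d_cvg0 : d @ \oo --> 0.
  rewrite -[0](mul0r gam^-1); apply: cvgM => //; exact: cvg_cst.
pose X n x k := g (m * k + n)%N x / gam ^+ k.
have gk k : 0 < gam ^+ k by rewrite exprn_gt0.
have X_ge0 n x k : 0 <= x <= 1 -> 0 <= X n x k.
  by move=> x01; rewrite mulr_ge0 ?unit_start_ge0 // invr_ge0 ltW.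
have qmono k n : q ^+ ((m * k + n) %/ M) <= q ^+ (k %/ M).
  apply: ler_wiXn2l => //; first exact: ltW.
  apply: leq_div2r; apply: leq_trans (leq_addr _ _); exact: leq_pmull.
have X_step n x k : 0 <= x <= 1 -> `|X n x k.+1 - X n x k| <= d k * X n x k.
  move=> x01; have := near_gam (m * k + n)%N x x01.
  have -> : X n x k.+1 - X n x k =
      (g (m * k + n + m)%N x - gam * g (m * k + n)%N x) / gam ^+ k.+1.
    rewrite /X mulnS -addnA addnC exprS; field.
    by rewrite !gt_eqF.
  move=> h; rewrite normrM normfV [`|gam ^+ k.+1|]ger0_norm ?(ltW (gk _)) //.
  rewrite ler_pdivrMr //; apply: le_trans h _; rewrite mulr1.
  have -> : d k * X n x k * gam ^+ k.+1 = q ^+ (k %/ M) * g (m * k + n)%N x.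
    by rewrite /d /X exprS; field; rewrite !gt_eqF.
  by rewrite ler_wpM2r ?unit_start_ge0.
pose B := expR (M%:R / (1 - q) / gam).
have X_le n x k : 0 <= x <= 1 -> X n x k <= B.
  move=> x01; have := @perturbed_le _ _ _ _ d_ge0 d_sum (fun k => X_ge0 n x k x01)
    (fun k => X_step n x k x01) k.
  move=> h; apply: le_trans h _; rewrite ler_piMr ?expR_ge0 //.
  by rewrite /X expr0 divr1 unit_start_le1.
pose F n x := limn (X n x).
have F_lim n x : 0 <= x <= 1 -> X n x k @[k --> \oo] --> F n x.
  move=> x01; exact: (@perturbed_cvg _ _ _ _ d_ge0 d_sum (fun k => X_ge0 n x k x01)
    (fun k => X_step n x k x01)).
have g_le k n x : 0 <= x <= 1 -> g (m * k + n)%N x <= B * gam ^+ k.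
  by move=> x01; rewrite -ler_pdivrMr // X_le.
have F_per n x : 0 <= x <= 1 -> F (n + m)%N x = gam * F n x.
  move=> x01; have h1 := F_lim (n + m)%N x x01.
  have h2 : X (n + m)%N x k @[k --> \oo] --> gam * F n x.
    have -> : X (n + m)%N x = (fun k => gam * X n x k.+1).
      apply/funext => k; rewrite /X exprS.
      have -> : (m * k + (n + m) = m * k.+1 + n)%N by rewrite mulnS [(n + m)%N]addnC addnA [(m * k + m)%N]addnC.
      by field; rewrite !gt_eqF.
    apply: cvgM; first exact: cvg_cst.
    by have := F_lim n x x01; rewrite -cvg_shiftS.
  exact: cvg_unique h1 h2.
(* Passing to the limit uses two derivatives of the rescaled densities, so the recursion is first
   obtained from index [n + 1] on; the scaling by [gam] then brings it down to index 0. *)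
have tF1 n : prim (Q n.+1) (F n.+2) (F n.+1).
  have pX k : prim (Q n.+1) (fun x => X n.+2 x k) (fun x => X n.+1 x k).
    have := primZ (gam ^+ k)^-1 (tg (m * k + n.+1)%N).
    by rewrite -addnS perk' => h; apply: prim_eq h => x _; rewrite mulrC.
  have pX' k : prim (Q n) (fun x => X n.+1 x k) (fun x => X n x k).
    have := primZ (gam ^+ k)^-1 (tg (m * k + n)%N).
    by rewrite -addnS perk' => h; apply: prim_eq h => x _; rewrite mulrC.
  split.
    apply: (@deriv01_lim _ _ _ (fun k x => X n.+2 x k)
       (fun k x => sgnb R (Q n.+1) * X n.+1 x k)
       (fun k x => sgnb R (Q n.+1) * (sgnb R (Q n) * X n x k)) B).
    - by move=> k; case: (pX k).
    - by move=> k; apply: deriv01Z; case: (pX' k).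
    - move=> k x x01; rewrite normrM normrM.
      have sg b : `|sgnb R b| = 1 by case: b; rewrite /sgnb ?normrN1 ?normr1.
      by rewrite !sg !mul1r ger0_norm ?X_ge0 // X_le.
    - by move=> x; exact: F_lim.
    - by move=> x x01; apply: cvgM; [exact: cvg_cst|exact: F_lim].
  have i1 : 0 <= (1 : R) <= 1 by lra.
  case: (Q n.+1) pX => pX.
    have h : X n.+2 0 @ \oo --> 0.
      have -> : X n.+2 0 = fun=> 0 by apply/funext => k; case: (pX k).
      exact: cvg_cst.
    exact: cvg_unique (F_lim n.+2 0 i0) h.
  have h : X n.+2 1 @ \oo --> 0.
    have -> : X n.+2 1 = fun=> 0 by apply/funext => k; case: (pX k).
    exact: cvg_cst.
  exact: cvg_unique (F_lim n.+2 1 i1) h.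
have tF : tseq Q F.
  move=> n; have := tF1 (n + m).-1; rewrite prednK ?addn_gt0 ?m_gt0 ?orbT // Q_per.
  move=> /(primZ gam^-1); rewrite -addSn => h.
  by apply: prim_eq h => x x01; rewrite F_per // mulKf // gt_eqF.
(* The Harnack profile is positive at 0, so all rescaled values there are positive and their limit
   cannot vanish. *)
have FN : F N 0 != 0.
  rewrite gt_eqF // /F; apply: (@perturbed_gt0 _ _ _ _ d_ge0 d_sum) => //.
  - by move=> k; exact: X_ge0.
  - by move=> k; exact: X_step.
  - move=> k; rewrite /X divr_gt0 // addnC.
    have [al al0 /(_ 0 i0)] := harnack_k k; rewrite subr0 !mulr1 => /andP[h _].
    by apply: lt_le_trans h; rewrite mulr_gt0.
(* Nonvanishing passes forward from [N] to [n + N * m], then back to [n] by the scaling. *)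
have F_neq0 n : exists2 x, 0 <= x <= 1 & F n x != 0.
  have [|x x01 Fx] := @tseq_neq0 _ _ F N (n + N * m) tF _ (ex_intro2 _ _ 0 i0 FN).
    by apply: leq_trans (leq_addl _ _); rewrite leq_pmulr.
  exists x => //; apply: contra_neq Fx => Fn0.
  elim: (N) => [|k IHk]; first by rewrite addn0.
  by rewrite mulSnr addnA F_per // IHk mulr0.
exists gam, F; split => //.
  by split => //; exists B => k n x; exact: g_le.
move=> G tG [C GC] G_per.
have GC' x : 0 <= x <= 1 -> - C * g 0%N x <= G 0%N x <= C * g 0%N x.
  by move=> x01; have := GC x x01; rewrite g0 // ler_norml; lra.
have C0 : - C <= C by have := GC 0 i0; have := normr_ge0 (G 0%N 0); lra.
(* The ratio of [G] to [g] tends to [e]. After division by [gam ^+ k] the left side is constant in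
   [k], and the error vanishes because [g] is at most [B * gam ^+ k]. *)
have [e [he _]] := ratio g G (- C) C tg tG g00 unit_start_neq0 GC' C0.
exists e => n x x01; apply/eqP; rewrite -subr_eq0 -normr_le0.
have cv1 : `|G n x - e * X n x k| @[k --> \oo] --> `|G n x - e * F n x|.
  apply: cvg_norm; apply: cvgB; first exact: cvg_cst.
  by apply: cvgM; [exact: cvg_cst|exact: F_lim].
have cv2 : q ^+ (k %/ M) * ((C - - C) * B) @[k --> \oo] --> 0.
  by rewrite -[0](mul0r ((C - - C) * B)); apply: cvgM => //; exact: cvg_cst.
apply: (ler_cvg_to cv1 cv2); apply: nearW => k.
have GX : G n x = G (m * k + n)%N x / gam ^+ k.
  elim: k => [|k IHk]; first by rewrite muln0 expr0 divr1.
  rewrite IHk mulnS -addnA [(m + _)%N]addnC G_per // exprS; field.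
  by rewrite !gt_eqF.
have -> : G n x - e * X n x k = (G (m * k + n)%N x - e * g (m * k + n)%N x) / gam ^+ k.
  by rewrite {1}GX /X; ring.
rewrite normrM normfV [`|gam ^+ k|]ger0_norm ?(ltW (gk _)) // ler_pdivrMr //.
apply: le_trans (he _ x x01) _; rewrite -!mulrA.
apply: ler_pM => //; rewrite ?mulr_ge0 ?exprn_ge0 ?unit_start_ge0 //; first by lra.
by apply: ler_wpM2l; [lra|exact: g_le].
Qed.

End PerronLimit.

(** * Spectral solutions as periodic sequences *)

Lemma periodic_seq_mod m (p : m.-tuple bool) i j :
  i = j %[mod m] -> periodic_seq p i = periodic_seq p j.
Proof. by move=> ij; rewrite /periodic_seq -modnDml ij modnDml. Qed.

Lemma periodic_seq_last m (p : m.-tuple bool) : (0 < m)%N ->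
  last 0%N (zeros p) = m -> periodic_seq p m = false.
Proof.
move=> m_gt0 last_m; case E : (zeros p) last_m => [|k s] /=; first by lia.
move=> last_m; have : m \in zeros p by rewrite E -last_m mem_last.
by rewrite mem_filter => /andP[/negbTE].
Qed.

Section Signs.
Variables (R : realType) (m : nat) (p : m.-tuple bool).
Local Notation Q := (fun n => periodic_seq p n.+1).

Lemma sgnb_mul b : sgnb R b * sgnb R b = 1.
Proof. by rewrite /sgnb; case: b; rewrite ?mulrNN mulr1. Qed.

(** T_0 u has derivative - u. Multiplying the k-th function by this accumulated sign makes each
    function the exact derivative of the next; one period produces the factor (-1)^r of the
    differential equation. *)
Definition eps (k : nat) : R := \prod_(j < k) sgnb R (periodic_seq p j.+1).

Lemma epsS k : eps k.+1 = eps k * sgnb R (Q k).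
Proof. by rewrite /eps big_ord_recr. Qed.

Lemma eps_mul k : eps k * eps k = 1.
Proof.
elim: k => [|k IHk]; first by rewrite /eps big_ord0 mulr1.
by rewrite epsS mulrACA IHk sgnb_mul mulr1.
Qed.

Lemma eps_neq0 k : eps k != 0.
Proof. by apply/eqP => e0; have := eps_mul k; rewrite e0 mulr0 => /eqP; rewrite eq_sym oner_eq0. Qed.

Lemma norm_eps k : `|eps k| = 1.
Proof. by apply/eqP; rewrite -(@pexpr_eq1 _ _ 2) ?normr_ge0 // -normrX expr2 eps_mul normr1. Qed.

Lemma eps_period : eps m = (-1) ^+ size (zeros p).
Proof.
have -> : eps m = \prod_(i <- iota 1 m) sgnb R (periodic_seq p i).
  rewrite /eps -(big_mkord xpredT (fun j => sgnb R (periodic_seq p j.+1))).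
  by rewrite -(big_add1 _ _ 0 m.+1 xpredT (fun j => sgnb R (periodic_seq p j))) /index_iota subSS subn0.
rewrite /zeros size_filter; elim: (iota 1 m) => [|i s IHs]; first by rewrite big_nil.
rewrite big_cons IHs /= exprD; congr (_ * _).
by rewrite /sgnb; case: (periodic_seq p i).
Qed.

Lemma epsD k : eps (k + m) = (-1) ^+ size (zeros p) * eps k.
Proof.
elim: k => [|k IHk]; first by rewrite add0n eps_period /eps big_ord0 mulr1.
rewrite addSn !epsS IHk mulrA; congr (_ * sgnb R _).
by apply: periodic_seq_mod; rewrite -addSn modnDr.
Qed.

End Signs.

Section Spectral.
Variables (R : realType) (m : nat) (p : m.-tuple bool).
Hypothesis m_gt0 : (0 < m)%N.
Local Notation Q := (fun n => periodic_seq p n.+1).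
Local Notation eps := (eps R p).

(** The equation u^(m) = s u defines derivatives of all orders. The boundary conditions then become
    a single congruence between the order [i] and the letter [k], which is free of truncated
    subtraction. *)
Lemma spectral_chain l (lambda : R) u : (l < m)%N -> spectral_solution p l lambda u ->
  exists w : nat -> R -> R, [/\ w 0%N = u,
    forall i, deriv01 (w i) (w i.+1),
    forall i x, 0 <= x <= 1 ->
      w (i + m)%N x = (-1) ^+ size (zeros p) * lambda ^+ m * w i x &
    forall i k, i + k = m + l - 1 %[mod m] ->
      if periodic_seq p k then w i 0 = 0 else w i 1 = 0].
Proof.
move=> lm [v [v0 dv vm bc]]; pose s : R := (-1) ^+ size (zeros p) * lambda ^+ m.
exists (fun i x => s ^+ (i %/ m) * v (i %% m)%N x); split.
- by rewrite div0n mod0n v0; apply/funext => x; rewrite mul1r.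
- move=> i; have im : (i %% m < m)%N by rewrite ltn_mod.
  have dvi := deriv01Z (s ^+ (i %/ m)) ((derivative_onP _ _).1 (dv _ im)).
  have [im1|im1] := ltnP (i %% m).+1 m.
    have -> : (i.+1 %/ m = i %/ m)%N.
      by rewrite {1}(divn_eq i m) -addnS divnMDl // (divn_small im1) addn0.
    have -> : (i.+1 %% m = (i %% m).+1)%N.
      by rewrite {1}(divn_eq i m) -addnS modnMDl (modn_small im1).
    exact: dvi.
  have E : (i %% m).+1 = m by apply/eqP; rewrite eqn_leq im.
  have -> : (i.+1 %/ m = (i %/ m).+1)%N.
    by rewrite {1}(divn_eq i m) -addnS E divnMDl // divnn m_gt0 addn1.
  have -> : (i.+1 %% m = 0)%N.
    by rewrite {1}(divn_eq i m) -addnS E modnMDl modnn.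
  apply: deriv01_eq dvi => // x x01.
  by rewrite E vm ?in_itv // v0 exprSr mulrA.
- by move=> i x _; rewrite divnDr ?dvdnn // divnn m_gt0 addn1 modnDr exprS mulrA.
- move=> i k ik; have im : (i %% m < m)%N by rewrite ltn_mod.
  have -> : periodic_seq p k = periodic_seq p (m + l - i %% m - 1).
    apply: periodic_seq_mod; apply/eqP; rewrite -(eqn_modDl (i %% m)) modnDml ik.
    by apply/eqP; congr (_ %% _)%N; lia.
  by have := bc _ im; case: periodic_seq => ->; rewrite mulr0.
Qed.

(* The exponent of [s] and the multiple of [m] in the index only keep the
   truncated subtraction from underflowing: [w (i + m) = s * w i]. *)
Lemma chain_tseq l (s : R) (w : nat -> R -> R) : s != 0 ->
  (forall i, deriv01 (w i) (w i.+1)) ->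
  (forall i x, 0 <= x <= 1 -> w (i + m)%N x = s * w i x) ->
  (forall i k, i + k = m + l - 1 %[mod m] ->
      if periodic_seq p k then w i 0 = 0 else w i 1 = 0) ->
  tseq Q (fun k x => eps k * s ^- k * w (k * m + (m + l - 1) - k)%N x).
Proof.
move=> s0 dw w_per bc k.
have kkm : (k <= k * m)%N by rewrite leq_pmulr.
have E : ((k.+1 * m + (m + l - 1) - k.+1).+1 = k * m + (m + l - 1) - k + m)%N.
  by rewrite mulSn; lia.
split.
  apply: deriv01_eq (deriv01Z (eps k.+1 * s ^- k.+1) (dw _)) => // x x01.
  rewrite E w_per // epsS exprS; field.
  by rewrite expf_neq0.
have := bc (k.+1 * m + (m + l - 1) - k.+1)%N k.+1.
rewrite subnK; last by rewrite mulSn; lia.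
by move=> /(_ (modnMDl _ _ _)); case: periodic_seq => ->; rewrite mulr0.
Qed.

(** The recursion integrates while the chain differentiates, so the order is reversed, with [u] at
    index [m + l - 1]. Over a period the sign (-1)^r cancels that of 1 / s, which leaves
    [lambda ^- m]. *)
Lemma eigen_tseq l (lambda : R) u : (l < m)%N -> 0 < lambda ->
  spectral_solution p l lambda u ->
  exists G, [/\ tseq Q G,
    exists C, forall x, 0 <= x <= 1 -> `|G 0%N x| <= C,
    forall n x, 0 <= x <= 1 -> G (n + m)%N x = lambda ^- m * G n x &
    forall x, 0 <= x <= 1 -> u x = eps (m + l - 1) * G (m + l - 1)%N x].
Proof.
move=> lm la0 sol; have [w [w0 dw w_per bc]] := spectral_chain lm sol.
set s := (-1) ^+ size (zeros p) * lambda ^+ m in w_per.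
have s0 : s != 0 by rewrite mulf_neq0 ?signr_eq0 // expf_neq0 // gt_eqF.
have wM k i x : 0 <= x <= 1 -> w (k * m + i)%N x = s ^+ k * w i x.
  move=> x01; elim: k => [|k IHk]; first by rewrite mul1r.
  by rewrite mulSnr addnAC w_per // IHk exprS mulrA.
exists (fun k x => eps k * s ^- k * w (k * m + (m + l - 1) - k)%N x).
split; first exact: chain_tseq.
- have [C hC] := deriv01_bounded (dw (m + l - 1)%N).
  by exists C => x x01; rewrite /eps big_ord0 expr0 invr1 !mul1r subn0 add0n hC.
- move=> n x x01.
  have nnm : (n <= n * m)%N by rewrite leq_pmulr.
  have -> : ((n + m) * m + (m + l - 1) - (n + m) = (m.-1) * m + (n * m + (m + l - 1) - n))%N.
    by case: (m) m_gt0 nnm => // m' _ /=; rewrite mulnDl mulSn; lia.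
  rewrite wM // epsD exprD.
  have -> : s ^+ m = s ^+ m.-1 * s by rewrite -exprSr prednK.
  have s1 : s = (-1) ^+ size (zeros p) * lambda ^+ m by [].
  have sg : (-1) ^+ size (zeros p) * (-1) ^+ size (zeros p) = 1 :> R.
    by rewrite -expr2 sqrr_sign.
  have la_neq0 : lambda ^+ m != 0 by rewrite expf_neq0 // gt_eqF.
  move: (s ^+ m.-1) (expf_neq0 m.-1 s0) (s ^+ n) (expf_neq0 n s0) => t t0 t' t'0.
  rewrite s1; move: ((-1) ^+ _) sg (lambda ^+ m) la_neq0 => e ee L L0.
  have e0 : e != 0 by apply/eqP => e0; move: ee; rewrite e0 mul0r => /eqP; rewrite eq_sym oner_eq0.
  by field; rewrite t'0 L0 e0 t0.
- move=> x x01.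
  by rewrite addnK -[((m + l - 1) * m)%N]addn0 wM // w0 -[eps _ * _ * _]mulrA mulKf
    ?expf_neq0 // mulrA eps_mul mul1r.
Qed.

(** Starting one period later keeps [N - i] a true subtraction for all [i <= m]; it only rescales
    the eigenfunction. *)
Lemma tseq_eigen l (lambda gam : R) F : (l < m)%N -> tseq Q F ->
  (forall n x, 0 <= x <= 1 -> F (n + m)%N x = gam * F n x) ->
  gam * lambda ^+ m = 1 ->
  spectral_solution p l lambda (fun x => eps (m + (m + l - 1)) * F (m + (m + l - 1))%N x).
Proof.
move=> lm tF F_per gamla; pose N := (m + (m + l - 1))%N.
exists (fun i x => eps (N - i)%N * F (N - i)%N x); split.
- by rewrite subn0.
- move=> i im; apply/derivative_onP.
  have E : (N - i = (N - i.+1).+1)%N by rewrite /N; lia.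
  have [dF _] := tF (N - i.+1)%N; rewrite E.
  apply: deriv01_eq (deriv01Z (eps (N - i.+1).+1) dF) => // x x01.
  by rewrite epsS -mulrA [sgnb R _ * _]mulrA sgnb_mul mul1r.
- move=> x; rewrite in_itv /= => x01.
  have -> : (N - m = m + l - 1)%N by rewrite /N; lia.
  rewrite /N [(m + (m + l - 1))%N]addnC F_per // epsD.
  have sg : (-1) ^+ size (zeros p) * (-1) ^+ size (zeros p) = 1 :> R.
    by rewrite -expr2 sqrr_sign.
  move: ((-1) ^+ _) sg => e ee.
  transitivity ((e * e) * (gam * lambda ^+ m) * (eps (m + l - 1) * F (m + l - 1)%N x)).
    by rewrite ee gamla !mul1r.
  by ring.
- move=> i im; have E : (N - i = (N - i.+1).+1)%N by rewrite /N; lia.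
  have [_] := tF (N - i.+1)%N; rewrite -E.
  have -> : periodic_seq p (N - i) = periodic_seq p (m + l - i - 1).
    apply: periodic_seq_mod; have -> : (N - i = m + (m + l - i - 1))%N by rewrite /N; lia.
    by rewrite modnDl.
  by case: periodic_seq => ->; rewrite mulr0.
Qed.

End Spectral.

(** * Exponential series *)

Section ExponentialSums.
Variable R : realType.
Implicit Types (al : nat -> R) (K : nat) (D q x : R).

Definition psum al K x : R := \sum_(k < K) al k * (x ^+ k / k`!%:R).

Lemma psum_deriv al K :
  prim true (fun x => psum al K.+1 x - al 0%N) (psum (fun k => al k.+1) K).
Proof.
elim: K => [|K IHK].
  apply: (@prim_eq _ _ (fun=> 0) _ (fun=> 0)).
  - by move=> x _; rewrite /psum big_ord1 expr0 fact0 divr1 mulr1 subrr.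
  - by move=> x _; rewrite /psum big_ord0.
  - by split => //; apply: deriv01_eq (deriv01_cst 0) => // x _; rewrite mulr0.
apply: prim_eq (prim_lin 1 (al K.+1) IHK (prim_expn R K)) => x _.
  by rewrite mul1r /psum [in RHS]big_ord_recr /=; ring.
by rewrite mul1r /psum [in RHS]big_ord_recr.
Qed.

Lemma psum_le al K D q x : 0 <= q -> (forall k, `|al k| <= D * q ^+ k) ->
  0 <= x <= 1 -> `|psum al K x| <= D * expR q.
Proof.
move=> q0 alD /andP[x0 x1].
have D0 : 0 <= D by have := alD 0%N; rewrite expr0 mulr1; apply: le_trans.
apply: le_trans (ler_norm_sum _ _ _) _.
apply: (@le_trans _ _ (D * series (exp_coeff q) K)).
  rewrite /series /= big_mkord mulr_sumr; apply: ler_sum => k _.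
  have f0 : 0 <= (k`!%:R : R)^-1 by rewrite invr_ge0.
  rewrite normrM; apply: le_trans (ler_wpM2r (normr_ge0 _) (alD k)) _.
  rewrite -mulrA ler_wpM2l // ler_wpM2l ?exprn_ge0 //.
  by rewrite ger0_norm ?mulr_ge0 ?exprn_ge0 // ler_piMl // exprn_ile1.
apply: ler_wpM2l => //; apply: nondecreasing_cvgn_le; last exact: is_cvg_series_exp_coeff.
by apply: nondecreasing_series => n _ _; exact: exp_coeff_ge0.
Qed.

Lemma psum_cvg al D q x : 0 <= q -> (forall k, `|al k| <= D * q ^+ k) ->
  0 <= x <= 1 -> cvgn (fun K => psum al K x).
Proof.
move=> q0 alD /andP[x0 x1].
have -> : (fun K => psum al K x) = series (fun k => al k * (x ^+ k / k`!%:R)).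
  by apply/funext => K; rewrite /series /= big_mkord.
have D0 : 0 <= D by have := alD 0%N; rewrite expr0 mulr1; apply: le_trans.
apply: normed_cvg; apply: (@series_le_cvg _ _ (fun k => D * exp_coeff q k)).
- by move=> k; exact: normr_ge0.
- by move=> k; rewrite mulr_ge0 // exp_coeff_ge0.
- move=> k; have f0 : 0 <= (k`!%:R : R)^-1 by rewrite invr_ge0.
  rewrite /= normrM; apply: le_trans (ler_wpM2r (normr_ge0 _) (alD k)) _.
  rewrite /exp_coeff /= -mulrA ler_wpM2l // ler_wpM2l ?exprn_ge0 //.
  by rewrite ger0_norm ?mulr_ge0 ?exprn_ge0 // ler_piMl // exprn_ile1.
have -> : series (fun k => D * exp_coeff q k) = (fun n => D * series (exp_coeff q) n).
  by apply/funext => n; rewrite /series /= mulr_sumr.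
by apply: is_cvgM; [exact: is_cvg_cst|exact: is_cvg_series_exp_coeff].
Qed.

Definition egf al x : R := limn (fun K => psum al K x).

Lemma egf0 al : egf al 0 = al 0%N.
Proof.
apply: cvg_lim => //; rewrite -cvg_shiftS.
have -> : (fun n => psum al n.+1 0) = fun=> al 0%N; last exact: cvg_cst.
apply/funext => n; rewrite /psum big_ord_recl expr0 divr1 mulr1 big1 ?addr0 // => i _.
by rewrite expr0n mul0r mulr0.
Qed.

Lemma egf_deriv al D q : 0 <= q -> (forall k, `|al k| <= D * q ^+ k) ->
  deriv01 (egf al) (egf (fun k => al k.+1)).
Proof.
move=> q0 alD.
have alD1 k : `|al k.+1| <= D * q * q ^+ k by rewrite -mulrA -exprS.
have alD2 k : `|al k.+2| <= D * q * q * q ^+ k by rewrite -!mulrA -!exprS.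
have psum' be K : deriv01 (psum be K.+1) (psum (fun k => be k.+1) K).
  have [db _] := psum_deriv be K.
  apply: deriv01_eq (deriv01D db (deriv01_cst (be 0%N))) => x _; first by rewrite subrK.
  by rewrite mul1r addr0.
(* The lengths K + 2, K + 1, K are staggered so that each partial sum is exactly the derivative of
   the previous one. *)
apply: (@deriv01_lim _ _ _ (fun K => psum al K.+2) (fun K => psum (fun k => al k.+1) K.+1)
  (fun K => psum (fun k => al k.+2) K) (D * q * q * expR q)) => //.
- by move=> K x x01; exact: psum_le.
- move=> x x01; have := psum_cvg q0 alD x01.
  by rewrite -(cvg_shiftn 2); under eq_fun do rewrite addn2; apply.
- move=> x x01; have := psum_cvg q0 alD1 x01.
  by rewrite -(cvg_shiftn 1); under eq_fun do rewrite addn1; apply.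
Qed.

Lemma chain_taylor (w : nat -> R -> R) D q : 0 <= q ->
  (forall i, deriv01 (w i) (w i.+1)) ->
  (forall i x, 0 <= x <= 1 -> `|w i x| <= D * q ^+ i) ->
  forall i x, 0 <= x <= 1 -> psum (fun k => w (i + k)%N 0) K x @[K --> \oo] --> w i x.
Proof.
move=> q0 dw wD.
(* Integrating from 0 the order-K remainder of [w i.+1] gives the order-(K+1) remainder of [w i], so
   the bound follows by comparing primitives. *)
have rest K : forall i x, 0 <= x <= 1 ->
    `|w i x - psum (fun k => w (i + k)%N 0) K x| <= D * q ^+ (i + K) * (x ^+ K / K`!%:R).
  elim: K => [|K IHK] i x x01.
    by rewrite /psum big_ord0 subr0 addn0 expr0 divr1 mulr1 wD.
  have pw : prim true (fun y => w i y - psum (fun k => w (i + k)%N 0) K.+1 y)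
      (fun y => w i.+1 y - psum (fun k => w (i.+1 + k)%N 0) K y).
    have p1 : prim true (fun y => w i y - w i 0) (w i.+1).
      split; last by rewrite subrr.
      apply: deriv01_eq (deriv01D (dw i) (deriv01_cst (- w i 0))) => // y _.
      by rewrite addr0 mul1r.
    have := prim_lin 1 (-1) p1 (psum_deriv (fun k => w (i + k)%N 0) K).
    apply: prim_eq => y _; first by rewrite addn0; ring.
    by rewrite mul1r mulN1r; congr (_ - _); apply: eq_bigr => k _; rewrite addSnnS.
  have pK := primZ (D * q ^+ (i + K.+1)) (prim_expn R K).
  have pK' := primZ (-1) pK.
  rewrite ler_norml; apply/andP; split.
    rewrite -mulN1r; apply: prim_le pK' pw _ x x01 => y y01.
    by have := IHK i.+1 y y01; rewrite addSnnS ler_norml mulN1r => /andP[].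
  apply: prim_le pw pK _ x x01 => y y01.
  by have := IHK i.+1 y y01; rewrite addSnnS ler_norml => /andP[].
move=> i x x01; apply/cvgrPdist_le => e e0.
have : (D * q ^+ i) * exp_coeff q K @[K --> \oo] --> (D * q ^+ i) * 0.
  by apply: cvgM; [exact: cvg_cst|exact: cvg_exp_coeff].
rewrite mulr0 => /cvgrPdist_le /(_ e e0); apply: filterS => K.
rewrite sub0r normrN => h; apply: le_trans (rest K i x x01) _; apply: le_trans h.
have D0 : 0 <= D * q ^+ i by apply: le_trans (wD i x x01).
have f0 : 0 <= (K`!%:R : R)^-1 by rewrite invr_ge0.
rewrite ger0_norm; last by rewrite mulr_ge0 // exp_coeff_ge0.
have -> : D * q ^+ (i + K) * (x ^+ K / K`!%:R) = D * q ^+ i * (x ^+ K * exp_coeff q K).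
  by rewrite /exp_coeff /= exprD; ring.
rewrite ler_wpM2l // ler_piMl ?exp_coeff_ge0 // exprn_ile1 //; case/andP: x01 => //.
Qed.

End ExponentialSums.

(** * Complex limits and Olivier functions *)

Section ComplexLimits.
Variable R : realType.
Local Notation C := (R[i] : numFieldType).
Local Notation nc := (@complex.ComplexField.Normc.normc R).
Implicit Types z t : R[i].

Lemma norm_normc z : `|z| = ((nc z)%:C)%C.
Proof. by []. Qed.

Lemma normc_Re z : `|complex.Re z| <= nc z.
Proof. by have := normc_ge_Re z; rewrite norm_normc lecR. Qed.

Lemma normc_Im z : `|complex.Im z| <= nc z.
Proof.
by case: z => a b; rewrite /= -sqrtr_sqr ler_wsqrtr // lerDr sqr_ge0.
Qed.

Lemma normc_le z : nc z <= `|complex.Re z| + `|complex.Im z|.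
Proof.
case: z => a b /=; rewrite -[leRHS]ger0_norm ?addr_ge0 // -sqrtr_sqr ler_wsqrtr //.
rewrite sqrrD !real_normK ?num_real // lerD2r lerDl mulrn_wge0 // mulr_ge0 //.
Qed.

Lemma cvg_complex (z : nat -> C) (a b : R) :
  complex.Re (z n) @[n --> \oo] --> a -> complex.Im (z n) @[n --> \oo] --> b ->
  z @ \oo --> ((a +i* b)%C : C).
Proof.
move=> za zb; apply/cvgrPdist_le => e e0.
have [e' e'0 ->] : exists2 e' : R, 0 < e' & e = (e'%:C)%C.
  exists (complex.Re e); move: e0; rewrite ltcE /= => /andP[/eqP Im0 //].
  by case: e Im0 => r i /= ->.
have e20 : 0 < e' / 2 by rewrite divr_gt0.
move/cvgrPdist_le: za => /(_ _ e20); move/cvgrPdist_le: zb => /(_ _ e20).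
apply: filterS2 => n hb ha; rewrite norm_normc lecR; apply: le_trans (normc_le _) _.
by case: (z n) ha hb => x y /= ha hb; lra.
Qed.

Lemma Re_sum (I : Type) (s : seq I) (P : pred I) (F : I -> R[i]) :
  complex.Re (\sum_(i <- s | P i) F i) = \sum_(i <- s | P i) complex.Re (F i).
Proof.
apply: (big_morph (fun z => complex.Re z)) => //.
by move=> [a b] [c d].
Qed.

Lemma Im_sum (I : Type) (s : seq I) (P : pred I) (F : I -> R[i]) :
  complex.Im (\sum_(i <- s | P i) F i) = \sum_(i <- s | P i) complex.Im (F i).
Proof.
apply: (big_morph (fun z => complex.Im z)) => //.
by move=> [a b] [c d].
Qed.

Lemma Re_real_mul z (a : R) : complex.Re (z * (a%:C)%C) = complex.Re z * a.
Proof. by case: z => x y /=; rewrite mulr0 subr0. Qed.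

Lemma Im_real_mul z (a : R) : complex.Im (z * (a%:C)%C) = complex.Im z * a.
Proof. by case: z => x y /=; rewrite mulr0 add0r. Qed.

Lemma exp_sum_cvg (be : nat -> C) (D q : R) : 0 <= q ->
  (forall k, nc (be k) <= D * q ^+ k) ->
  (fun K => \sum_(k < K) be k / k`!%:R) @ \oo -->
    ((egf (fun k => complex.Re (be k)) 1 +i* egf (fun k => complex.Im (be k)) 1)%C : C).
Proof.
move=> q0 beD; have i1 : 0 <= (1 : R) <= 1 by lra.
have toR k : (k`!%:R : R[i])^-1 = ((k`!%:R^-1 : R)%:C)%C.
  by rewrite fmorphV rmorph_nat.
apply: cvg_complex.
  have -> : (fun n => complex.Re (\sum_(k < n) be k / k`!%:R))
    = (fun K => psum (fun k => complex.Re (be k)) K 1).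
    apply/funext => K; rewrite Re_sum; apply: eq_bigr => k _.
    by rewrite toR Re_real_mul expr1n mul1r.
  apply: (@psum_cvg _ _ D q) => // k; exact: le_trans (normc_Re _) (beD k).
have -> : (fun n => complex.Im (\sum_(k < n) be k / k`!%:R))
  = (fun K => psum (fun k => complex.Im (be k)) K 1).
  apply/funext => K; rewrite Im_sum; apply: eq_bigr => k _.
  by rewrite toR Im_real_mul expr1n mul1r.
apply: (@psum_cvg _ _ D q) => // k; exact: le_trans (normc_Im _) (beD k).
Qed.

Lemma normcX z k : nc (z ^+ k) = nc z ^+ k.
Proof.
elim: k => [|k IHk]; first exact: complex.ComplexField.Normc.normc1.
by rewrite !exprS complex.ComplexField.Normc.normcM IHk.
Qed.

Lemma normc_ge0 z : 0 <= nc z.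
Proof. by case: z => a b; exact: sqrtr_ge0. Qed.

Lemma sum_residue (V : nmodType) (m e J : nat) (F : nat -> V) : (e < m)%N ->
  \sum_(j < J) F (j * m + e)%N = \sum_(k < J * m) (if (k %% m == e)%N then F k else 0).
Proof.
move=> em; have m0 : (0 < m)%N by apply: leq_ltn_trans em.
elim: J => [|J IHJ]; first by rewrite mul0n !big_ord0.
rewrite big_ord_recr /= IHJ mulSnr big_split_ord /=; congr (_ + _).
rewrite (bigD1 (Ordinal em)) //= modnMDl modn_small // eqxx big1 ?addr0 // => i ie.
by rewrite modnMDl modn_small // ifN.
Qed.

Section Olivier.
Variables (m : nat) (t : R[i]).
Hypothesis m_gt0 : (0 < m)%N.

Lemma olivier_series e J : (e < m)%N ->
  series (fun j => t ^+ (j * m + e) / (j * m + e)`!%:R : C) J =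
  \sum_(k < J * m) (if (k %% m == e)%N then t ^+ k else 0) / k`!%:R.
Proof.
move=> em; rewrite /series /= big_mkord.
rewrite (sum_residue J (fun k => t ^+ k / k`!%:R) em).
by apply: eq_bigr => k _; case: ifP => //; rewrite mul0r.
Qed.

Lemma cvg_mulm : (fun J => J * m)%N @ \oo --> \oo.
Proof.
apply/cvgnyPge => n; exists n => // J /= nJ; apply: leq_trans nJ _.
exact: leq_pmulr.
Qed.

Lemma olivier_cvg e : (e < m)%N ->
  series (fun j => t ^+ (j * m + e) / (j * m + e)`!%:R : C) @ \oo
    --> (olivier m e t : C).
Proof.
move=> em.
have : cvgn (series (fun j => t ^+ (j * m + e) / (j * m + e)`!%:R : C)).
  have -> : series (fun j => t ^+ (j * m + e) / (j * m + e)`!%:R : C) =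
     (fun K => \sum_(k < K) ((if (k %% m == e)%N then t ^+ k else 0) : C) / k`!%:R) \o
     (fun J => J * m)%N.
    by apply/funext => J; rewrite olivier_series.
  have be k : nc ((if (k %% m == e)%N then t ^+ k else 0) : C) <= 1 * nc t ^+ k.
    rewrite mul1r; case: ifP => _; first by rewrite normcX.
    by rewrite complex.ComplexField.Normc.normc0 exprn_ge0 // normc_ge0.
  exact: cvgP (cvg_comp _ _ cvg_mulm (exp_sum_cvg (normc_ge0 t) be)).
exact.
Qed.

(** Periodic coefficients are constant on residue classes modulo [m], and each class of the
    exponential series sums to one Olivier function. Partial sums are compared at multiples of
    [m]. *)
Lemma olivier_sum (c : nat -> R[i]) (l : C) : (forall k, c (k + m)%N = c k) ->
  (fun K => \sum_(k < K) (t ^+ k * c k : C) / k`!%:R) @ \oo --> l ->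
  \sum_(e < m) c e * olivier m e (t : C) = l.
Proof.
move=> c_per cl.
have cM a k : c (a * m + k)%N = c k.
  by elim: a => [|a IHa] //; rewrite mulSnr addnAC c_per.
have c1 : (fun J => \sum_(e < m) (c e : C) *
    series (fun j => t ^+ (j * m + e) / (j * m + e)`!%:R : C) J) @ \oo -->
    (\sum_(e < m) c e * olivier m e (t : C) : C).
  apply: cvg_big => [|e _]; first exact: add_continuous.
  by apply: cvgM; [exact: cvg_cst|exact: olivier_cvg].
have c2 := cvg_comp _ _ cvg_mulm cl.
have E : (fun J => \sum_(e < m) (c e : C) *
    series (fun j => t ^+ (j * m + e) / (j * m + e)`!%:R : C) J) =
  ((fun K => \sum_(k < K) (t ^+ k * c k : C) / k`!%:R) \o (fun J => J * m)%N).
  apply/funext => J /=.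
  under eq_bigr => e _ do rewrite olivier_series ?ltn_ord // mulr_sumr.
  rewrite exchange_big /=; apply: eq_bigr => k _.
  have km : (k %% m < m)%N by rewrite ltn_mod.
  rewrite (bigD1 (Ordinal km)) //= eqxx big1 ?addr0; last first.
    move=> e; rewrite -val_eqE /= eq_sym => /negbTE ->; by rewrite mul0r mulr0.
  have -> : c (k %% m)%N = c k by rewrite {2}(divn_eq k m) cM.
  by rewrite mulrCA mulrA.
rewrite E in c1; exact: cvg_unique c1 c2.
Qed.

End Olivier.
End ComplexLimits.

(** * The Olivier matrix *)

Section OlivierMatrix.
Variables (R : realType) (m : nat) (p : m.-tuple bool).
Hypothesis m_gt0 : (0 < m)%N.
Hypothesis last_zero : last 0%N (zeros p) = m.
Local Notation P := (periodic_seq p).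
Local Notation C := (R[i] : numFieldType).
Local Notation nc := (@complex.ComplexField.Normc.normc R).
Local Notation phi t e := (olivier m e (t : C)).
Local Notation pos := (nth 0%N (0%N :: zeros p)).

(** The positions i_0 = 0, ..., i_(r-1) that index the matrix: the zero i_r = m is represented by
    its residue 0. *)
Definition residues := [seq k <- iota 0 m | ~~ P k].

Lemma zeros_rcons : 0%N :: zeros p = rcons residues m.
Proof.
have Pm := periodic_seq_last m_gt0 last_zero.
have P0 : P 0 = false by rewrite -Pm; apply: periodic_seq_mod; rewrite modnn mod0n.
have E1 : iota 1 m = rcons (iota 1 m.-1) m.
  by rewrite -{1}(prednK m_gt0) -[m.-1.+1]addn1 iotaD add1n prednK // cats1.
have E0 : iota 0 m = 0%N :: iota 1 m.-1 by rewrite -{1}(prednK m_gt0).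
by rewrite /zeros /residues E1 E0 filter_rcons /= Pm P0 rcons_cons.
Qed.

Lemma size_residues : size residues = size (zeros p).
Proof. by apply/eqP; rewrite -eqSS -(size_rcons _ m) -zeros_rcons. Qed.

Lemma nth_zeros k : (k < size (zeros p))%N -> pos k = nth 0%N residues k.
Proof. by move=> kr; rewrite zeros_rcons nth_rcons size_residues kr. Qed.

Lemma mem_residues i : (i \in residues) = (i < m)%N && ~~ P i.
Proof. by rewrite mem_filter mem_iota add0n andbC. Qed.

Lemma pos_res k : (k < size (zeros p))%N -> pos k \in residues.
Proof. by move=> kr; rewrite nth_zeros // mem_nth // size_residues. Qed.

Lemma sum_residues (h : nat -> R[i]) : (forall i, (i < m)%N -> P i -> h i = 0) ->
  \sum_(l < size (zeros p)) h (pos l) = \sum_(i < m) h i.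
Proof.
move=> h0; rewrite -(big_mkord xpredT (fun l => h (pos l))).
under eq_big_nat => l /andP[_ lr] do rewrite nth_zeros //.
rewrite -size_residues -(big_nth 0%N xpredT h) /residues big_filter.
have -> : iota 0 m = index_iota 0 m by rewrite /index_iota subn0.
rewrite big_mkord big_mkcond; apply: eq_bigr => i _.
by case: ifP => // /negbFE Pi; rewrite h0.
Qed.

(** Since [y] vanishes off the zeros of [p], the sum extends to all residues i; the substitution e =
    i_k - i mod m turns it into a convolution. The factor [m.-1 * e] encodes - e. *)
Lemma olivier_matrix_mul t (y : nat -> R[i]) (k : 'I_(size (zeros p))) :
  (forall i, (i < m)%N -> P i -> y i = 0) ->
  \sum_l olivier_matrix p t k l * y (pos l) =
  \sum_(e < m) y ((pos k + m.-1 * e) %% m)%N * phi t e.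
Proof.
move=> y0.
pose h i := phi t ((pos k + (m - i)) %% m)%N * y i.
transitivity (\sum_(l < size (zeros p)) h (pos l)).
  by apply: eq_bigr => l _; rewrite mxE.
rewrite sum_residues; last by move=> i im Pi; rewrite /h y0 // mulr0.
have rm i : ((pos k + (m - i)) %% m < m)%N by rewrite ltn_mod.
pose rf (i : 'I_m) := Ordinal (rm i).
have rfE (i : 'I_m) : i + rf i = pos k %[mod m].
  by rewrite /= modnDmr addnCA subnKC ?modnDr // ltnW.
have rf_inj : injective rf.
  move=> i j ij; apply/val_inj => /=.
  have := rfE i; rewrite ij -(rfE j) => /eqP; rewrite eqn_modDr => /eqP.
  by rewrite !modn_small.
rewrite [RHS](reindex_inj rf_inj) /=; apply: eq_bigr => i _.
have /= -> : ((pos k + m.-1 * rf i) %% m)%N = i :> nat.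
  apply: etrans (modn_small (ltn_ord i)); apply/eqP.
  by rewrite -(eqn_modDr (rf i)) -addnA -mulSnr prednK // addnC mulnC modnMDl rfE.
exact: mulrC.
Qed.

Lemma det_kernel t : \det (olivier_matrix p t) = 0 -> exists y : nat -> R[i],
  [/\ forall i, (i < m)%N -> P i -> y i = 0, exists2 i, (i < m)%N & y i != 0 &
    forall n, ~~ P n -> \sum_(e < m) y ((n + m.-1 * e) %% m)%N * phi t e = 0].
Proof.
rewrite -det_tr => /eqP/det0P[v v0 vM].
(* The positions are distinct, so this has at most one term: it extends the kernel vector by 0. *)
pose y i := \sum_(l < size (zeros p) | pos l == i) v 0 l.
have posK (l : 'I_(size (zeros p))) : y (pos l) = v 0 l.
  rewrite /y (bigD1 l) //= big1 ?addr0 // => j /andP[/eqP jl]; rewrite -val_eqE /= => /negP[].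
  move: jl; rewrite !nth_zeros // => /eqP; rewrite nth_uniq ?size_residues //.
  by rewrite filter_uniq // iota_uniq.
have y0 i : (i < m)%N -> P i -> y i = 0.
  move=> im Pi; rewrite /y big1 // => l /eqP li.
  by have := pos_res (ltn_ord l); rewrite li mem_residues Pi andbF.
exists y; split => //.
  have /rV0Pn[l vl] := v0; exists (pos l); last by rewrite posK.
  by have := pos_res (ltn_ord l); rewrite mem_residues => /andP[].
move=> n Pn.
have nres : (n %% m)%N \in residues.
  rewrite mem_residues ltn_mod m_gt0 /=.
  by rewrite (_ : P (n %% m)%N = P n) //; apply: periodic_seq_mod; rewrite modn_mod.
have kr : (index (n %% m)%N residues < size (zeros p))%N by rewrite -size_residues index_mem.
have := @olivier_matrix_mul t y (Ordinal kr) y0.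
rewrite [pos (Ordinal kr)]nth_zeros // nth_index //.
under [in RHS]eq_bigr => e _ do rewrite modnDml.
move=> <-; have := congr1 (fun u : 'rV_ _ => u 0 (Ordinal kr)) vM; rewrite !mxE => vk.
rewrite -[RHS]vk; apply: eq_bigr => l _; rewrite posK mulrC; congr (_ * _).
by rewrite [in RHS]mxE.
Qed.

End OlivierMatrix.

(** * Roots of the determinant *)

Section DetRoots.
Variables (R : realType) (m : nat) (p : m.-tuple bool).
Hypothesis m_gt0 : (0 < m)%N.
Hypothesis last_zero : last 0%N (zeros p) = m.
Local Notation P := (periodic_seq p).
Local Notation Q := (fun n => periodic_seq p n.+1).
Local Notation C := (R[i] : numFieldType).
Local Notation nc := (@complex.ComplexField.Normc.normc R).
Local Notation eps := (eps R p).

Definition re_im (b : bool) (z : R[i]) : R := if b then complex.Re z else complex.Im z.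

Lemma re_im_le b z : `|re_im b z| <= nc z.
Proof. by case: b; [exact: normc_Re|exact: normc_Im]. Qed.

Lemma normc_gt0 (z : R[i]) : (0 < nc z) = (z != 0).
Proof.
rewrite lt0r normc_ge0 andbT; congr negb; apply/eqP/eqP => [|->].
  exact: complex.ComplexField.Normc.eq0_normc.
exact: complex.ComplexField.Normc.normc0.
Qed.

Section Kernel.
Variables (t : R[i]) (y : nat -> R[i]).
Hypothesis t_neq0 : t != 0.
Hypothesis y0 : forall i, (i < m)%N -> P i -> y i = 0.
Hypothesis ker : forall n, ~~ P n ->
  \sum_(e < m) y ((n + m.-1 * e) %% m)%N * olivier m e (t : C) = 0.

(* Coefficient of [x ^ k / k!] in the complex solution; [m.-1 * k] stands for
   [- k] modulo [m]. *)
Definition kernel_coef n k : R[i] := t ^+ k * (t ^- n * y ((n + m.-1 * k) %% m)%N).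

(** Differentiation shifts the coefficients, so the solution of index [n.+1] has that of index [n]
    as its derivative. *)
Lemma kernel_coefS n k : kernel_coef n.+1 k.+1 = kernel_coef n k.
Proof.
rewrite /kernel_coef.
have -> : ((n.+1 + m.-1 * k.+1) %% m = (n + m.-1 * k) %% m)%N.
  rewrite mulnS (_ : (n.+1 + (m.-1 + m.-1 * k) = n + m.-1 * k + m)%N) ?modnDr //.
  by rewrite -{3}(prednK m_gt0); lia.
rewrite !exprS; move: (y _) (t ^+ n) (expf_neq0 n t_neq0) (t ^+ k) => z u u0 v.
by field; rewrite u0 t_neq0.
Qed.

Lemma kernel_coef_le n : exists D, forall k, nc (kernel_coef n k) <= D * nc t ^+ k.
Proof.
exists (nc (t ^- n) * \sum_(i < m) nc (y i)) => k.
rewrite /kernel_coef !complex.ComplexField.Normc.normcM normcX mulrC.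
rewrite ler_wpM2r ?exprn_ge0 ?normc_ge0 // ler_wpM2l ?normc_ge0 //.
have im : ((n + m.-1 * k) %% m < m)%N by rewrite ltn_mod.
by rewrite (bigD1 (Ordinal im)) //= lerDl sumr_ge0 // => i _; rewrite normc_ge0.
Qed.

Definition kernel_seq b n x := eps n * egf (fun k => re_im b (kernel_coef n k)) x.

(** For a letter 1 the value at 0 is a coefficient that vanishes by [y0]; for a letter 0 the value
    at 1 is the left side of a kernel equation. *)
Lemma kernel_seq_tseq b : tseq Q (kernel_seq b).
Proof.
move=> n; have [D hD] := kernel_coef_le n.+1.
have pD k : `|re_im b (kernel_coef n.+1 k)| <= D * nc t ^+ k by apply: le_trans (re_im_le _ _) (hD k).
split.
  apply: deriv01_eq (deriv01Z (eps n.+1) (egf_deriv (normc_ge0 t) pD)) => // x _.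
  have E : (fun k => re_im b (kernel_coef n.+1 k.+1)) = fun k => re_im b (kernel_coef n k).
    by apply/funext => k; rewrite kernel_coefS.
  by rewrite E /kernel_seq epsS mulrA [X in X * _ = _]mulrC.
rewrite /kernel_seq; case: ifPn => Pn.
  rewrite egf0 /kernel_coef muln0 addn0 y0 ?ltn_mod //; last first.
    by rewrite (_ : P (n.+1 %% m)%N = P n.+1) //; apply: periodic_seq_mod; rewrite modn_mod.
  by rewrite !mulr0 /re_im; case: (b); rewrite mulr0.
have e1 := exp_sum_cvg (normc_ge0 t) hD.
have per k : t ^- n.+1 * y ((n.+1 + m.-1 * (k + m)) %% m)%N =
    t ^- n.+1 * y ((n.+1 + m.-1 * k) %% m)%N.
  by congr (_ * y _); rewrite mulnDr addnA -modnDmr modnMl addn0.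
have := olivier_sum m_gt0 per e1.
under eq_bigr => e _ do rewrite -mulrA.
rewrite -mulr_sumr ker // mulr0 => /eqP; rewrite eq_sym eq_complex /= => /andP[/eqP re0 /eqP im0].
by case: (b); rewrite ?re0 ?im0 mulr0.
Qed.

Lemma kernel_seq0 b n : kernel_seq b n 0 = eps n * re_im b (t ^- n * y (n %% m)%N).
Proof. by rewrite /kernel_seq egf0 /kernel_coef expr0 mul1r muln0 addn0. Qed.

Lemma kernel_seq_bounded b : exists K, forall x, 0 <= x <= 1 -> `|kernel_seq b 0 x| <= K.
Proof.
have [D hD] := kernel_coef_le 0.
have pD k : `|re_im b (kernel_coef 0 k)| <= D * nc t ^+ k by apply: le_trans (re_im_le _ _) (hD k).
exists (D * expR (nc t)) => x x01; rewrite /kernel_seq normrM norm_eps mul1r.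
have cv := psum_cvg (normc_ge0 t) pD x01.
apply: (@cvgr_to_le _ _ _ _ _ _ _ (cvg_norm cv)); apply: nearW => K.
exact: psum_le (normc_ge0 t) pD x01.
Qed.

End Kernel.

(** At t = 0 only the constant term of phi_(m,0) survives, and the kernel equation at [i] reads y_i
    = 0. *)
Lemma det_root_neq0 (t : R[i]) : \det (olivier_matrix p t) = 0 -> t != 0.
Proof.
move=> /(det_kernel m_gt0 last_zero) [y [y0 [i im yi] ker]].
apply/eqP => t0; move: yi; apply/negP; rewrite negbK; apply/eqP.
have [Pi|Pi] := boolP (P i); first exact: y0.
have := ker i Pi; rewrite (@olivier_sum _ m t m_gt0 (fun k => y ((i + m.-1 * k) %% m)%N) (y i)) //.
  by move=> k; congr y; rewrite mulnDr addnA -modnDmr modnMl addn0.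
rewrite -cvg_shiftS.
have -> : (fun n => \sum_(k < n.+1) (t ^+ k * y ((i + m.-1 * k) %% m)%N : C) / k`!%:R)
   = fun=> y i; last exact: cvg_cst.
apply/funext => n; rewrite big_ord_recl expr0 mul1r divr1 muln0 addn0 modn_small //.
by rewrite big1 ?addr0 // => k _; rewrite t0 expr0n !mul0r.
Qed.

(** At 0 the solution of index m k + i has modulus |y_i| / |t|^(m k + i). Growth at most [gam ^+ k]
    bounds |y_i| by a multiple of (gam |t|^m)^k, which would force y_i = 0 if that base were below
    1. *)
Lemma det_root_ge (t : R[i]) (gam : R) : 0 < gam ->
  (forall G, tseq Q G -> (exists K, forall x, 0 <= x <= 1 -> `|G 0%N x| <= K) ->
     exists K, forall k n x, 0 <= x <= 1 -> `|G (m * k + n)%N x| <= K * gam ^+ k) ->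
  \det (olivier_matrix p t) = 0 -> 1 <= gam * nc t ^+ m.
Proof.
move=> gam0 growth det0; have t0 := det_root_neq0 det0.
have [y [y0 [i im yi] ker]] := det_kernel m_gt0 last_zero det0.
have [K1 h1] := growth _ (kernel_seq_tseq t0 y0 ker true) (kernel_seq_bounded t y true).
have [K2 h2] := growth _ (kernel_seq_tseq t0 y0 ker false) (kernel_seq_bounded t y false).
have tc0 : 0 < nc t by rewrite normc_gt0.
rewrite leNgt; apply/negP => lt1.
have i0 : 0 <= (0 : R) <= 1 by lra.
pose z := gam * nc t ^+ m.
have z0 : 0 <= z by rewrite mulr_ge0 ?exprn_ge0 // ltW.
have bound k : nc (y i) / nc t ^+ i <= (K1 + K2) * z ^+ k.
  have := h1 k i 0 i0; have := h2 k i 0 i0; rewrite !kernel_seq0 !normrM !norm_eps !mul1r.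
  rewrite mulnC modnMDl modn_small // /re_im => g2 g1.
  have := le_trans (normc_le _) (lerD g1 g2).
  rewrite complex.ComplexField.Normc.normcM complex.ComplexField.Normc.normcV normcX.
  rewrite -mulrDl => h; rewrite /z exprMn mulrA -ler_pdivrMr; last by rewrite !exprn_gt0.
  apply: le_trans h; rewrite -exprM exprD [(k * m)%N]mulnC.
  move: (nc t ^+ i) (exprn_gt0 i tc0) (nc t ^+ (m * k)) (exprn_gt0 (m * k) tc0) => a a0 b b0.
  by rewrite le_eqVlt; apply/orP; left; apply/eqP; field; rewrite !gt_eqF.
have : nc (y i) / nc t ^+ i <= (K1 + K2) * 0.
  have cv : (K1 + K2) * z ^+ k @[k --> \oo] --> (K1 + K2) * 0.
    apply: cvgM; [exact: cvg_cst|apply: cvg_expr]; by rewrite ger0_norm.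
  by apply: (cvgr_to_ge cv); apply: nearW.
by rewrite mulr0 leNgt divr_gt0 ?exprn_gt0 ?normc_gt0.
Qed.

End DetRoots.

(** * Eigenvalues are roots of the determinant *)

Section EigenDet.
Variables (R : realType) (m : nat) (p : m.-tuple bool).
Hypothesis m_gt0 : (0 < m)%N.
Hypothesis last_zero : last 0%N (zeros p) = m.
Local Notation P := (periodic_seq p).
Local Notation C := (R[i] : numFieldType).
Local Notation nc := (@complex.ComplexField.Normc.normc R).
Local Notation pos := (nth 0%N (0%N :: zeros p)).

Lemma chain_bound (s : R) (w : nat -> R -> R) :
  (forall i, deriv01 (w i) (w i.+1)) ->
  (forall i x, 0 <= x <= 1 -> w (i + m)%N x = s * w i x) ->
  exists D q, 0 <= q /\ forall i x, 0 <= x <= 1 -> `|w i x| <= D * q ^+ i.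
Proof.
move=> dw w_per; have [B hB] := choice (fun i => deriv01_bounded (dw i)).
pose q := Num.max 1 `|s|; pose D := \sum_(i < m) `|B i|.
have q1 : 1 <= q by rewrite le_max lexx.
have q0 : 0 <= q by lra.
exists D, q; split=> // i x x01.
have step a b : (b < m)%N -> `|w (a * m + b)%N x| <= D * q ^+ a.
  move=> bm; elim: a => [|a IHa].
    rewrite expr0 mulr1; apply: le_trans (hB b x x01) _.
    apply: le_trans (ler_norm _) _.
    by rewrite /D (bigD1 (Ordinal bm)) //= lerDl sumr_ge0.
  rewrite mulSnr addnAC w_per // normrM exprSr mulrA mulrC.
  by apply: ler_pM => //; rewrite le_max lexx orbT.
rewrite (divn_eq i m); apply: le_trans (step _ _ _) _; first by rewrite ltn_mod.
apply: ler_wpM2l; first by rewrite sumr_ge0.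
by apply: ler_weXn2l => //; rewrite (leq_trans (leq_pmulr _ m_gt0)) // leq_addr.
Qed.

Lemma exists_root (lambda : R) : 0 < lambda -> exists t : R[i],
  [/\ t != 0, nc t = lambda &
      t ^+ m = (((-1) ^+ size (zeros p) * lambda ^+ m)%:C)%C].
Proof.
move=> la0; pose z := m.-root ((-1) ^+ size (zeros p) : R[i]).
have zm : z ^+ m = (-1) ^+ size (zeros p) by rewrite rootCK.
have ncz : nc z = 1.
  have : nc z ^+ m = 1.
    rewrite -normcX zm normcX; have -> : nc (-1) = 1.
      by rewrite /= oppr0 expr0n addr0 sqrrN expr1n sqrtr1.
    exact: expr1n.
  by move=> /eqP; rewrite pexpr_eq1 ?normc_ge0 // => /eqP.
have nct : nc ((lambda%:C)%C * z) = lambda.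
  rewrite complex.ComplexField.Normc.normcM ncz mulr1 /= expr0n addr0.
  by rewrite sqrtr_sqr gtr0_norm.
exists ((lambda%:C)%C * z); split=> //.
  by rewrite -normc_gt0 nct.
by rewrite exprMn zm rmorphM rmorphXn /= rmorphXn rmorphN1 mulrC.
Qed.

(** With t^m = s, the Taylor coefficients of [u] at 0 divided by t^k are m-periodic. Indexed by the
    letter [j] instead of the order, they vanish where p_j = 1 by the conditions at 0, and the
    conditions at 1 are the kernel equations. *)
Lemma eigen_det l (lambda : R) u : (l < m)%N -> 0 < lambda ->
  eigenfunction p l lambda u ->
  exists t : R[i], \det (olivier_matrix p t) = 0 /\ nc t = lambda.
Proof.
move=> lm la0 [sol [x0 x0I ux0]]; have [w [w0 dw w_per bc]] := spectral_chain m_gt0 lm sol.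
set s := (-1) ^+ size (zeros p) * lambda ^+ m in w_per.
have [D [q [q0 wD]]] := chain_bound dw w_per.
have taylor := chain_taylor q0 dw wD.
have [t [t0 nct tm]] := exists_root la0; exists t; split=> //.
have i0 : 0 <= (0 : R) <= 1 by lra.
have i1 : 0 <= (1 : R) <= 1 by lra.
pose c k : R[i] := t ^- k * ((w k 0)%:C)%C.
have c_per k : c (k + m)%N = c k.
  have E : ((s * w k 0)%:C = t ^+ m * (w k 0)%:C)%C by rewrite tm -rmorphM.
  by rewrite /c w_per // E exprD invfM -mulrA mulKf // expf_neq0.
have c_mod a b : a = b %[mod m] -> c a = c b.
  have cM e k : c (e * m + k)%N = c k.
    by elim: e => [|e IHe] //; rewrite mulSnr addnAC c_per.
  by move=> ab; rewrite (divn_eq a m) (divn_eq b m) !cM ab.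
pose l' := (m + l - 1)%N; pose y j := c (l' + m.-1 * j)%N.
have neg j : l' + m.-1 * j + j = l' %[mod m].
  by rewrite -addnA -mulSnr prednK // -modnDmr modnMr addn0.
have y0 i : (i < m)%N -> P i -> y i = 0.
  move=> im Pi; have := bc (l' + m.-1 * i)%N i (neg i).
  by rewrite Pi /y /c => ->; rewrite mulr0.
have col (k : 'I_(size (zeros p))) : \sum_l olivier_matrix p t k l * y (pos l) = 0.
  rewrite olivier_matrix_mul //; pose i := (l' + m.-1 * pos k)%N.
  have Pk : P (pos k) = false.
    by have := pos_res m_gt0 last_zero (ltn_ord k); rewrite mem_residues => /andP[_ /negbTE].
  have wi1 : w i 1 = 0 by have := bc i (pos k) (neg _); rewrite Pk.
  under eq_bigr => e _.
    have -> : y ((pos k + m.-1 * e) %% m)%N = c (i + e)%N.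
      apply: c_mod; rewrite -modnDmr modnMmr modnDmr mulnDr addnA.
      apply/eqP; rewrite eqn_modDl -(eqn_modDr (m.-1 * e)) -!mulSnr -mulSn prednK //.
      by rewrite !modnMr.
    over.
  apply: (olivier_sum m_gt0 (c := fun e => c (i + e)%N)); first by move=> k'; rewrite addnA c_per.
  have -> : (fun K => \sum_(k < K) (t ^+ k * c (i + k)%N : C) / k`!%:R) =
     (fun K => (t ^- i : C) * ((psum (fun k => w (i + k)%N 0) K 1)%:C)%C).
    apply/funext => K; rewrite /psum rmorph_sum mulr_sumr; apply: eq_bigr => e _ /=.
    rewrite /c expr1n mul1r rmorphM fmorphV rmorph_nat /= exprD.
    by field; rewrite !expf_neq0 //= andbT pnatr_eq0 -lt0n fact_gt0.
  have -> : (0 : R[i]) = t ^- i * ((0 : R) +i* 0)%C by rewrite mulr0.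
  apply: cvgM; first exact: cvg_cst.
  apply: cvg_complex; last exact: cvg_cst.
  by have := taylor i 1 i1; rewrite wi1.
rewrite -det_tr; apply/eqP/det0P.
exists (\row_l y (pos l)); last first.
  apply/rowP => k; rewrite !mxE -[RHS](col k); apply: eq_bigr => e _.
  by rewrite !mxE mulrC.
(* Otherwise the Taylor series at 0, which represents [u], would make [u] vanish. *)
have [i wi] : exists i, w i 0 != 0.
  apply: contrapT => /forallNP h; move: ux0; apply/negP; rewrite negbK.
  have x01 : 0 <= x0 <= 1 by move: x0I; rewrite in_itv.
  have := taylor 0%N x0 x01; rewrite w0.
  have -> : (fun K => psum (fun k => w (0 + k)%N 0) K x0) = fun=> 0.
    apply/funext => K; rewrite /psum big1 // => k _.
    by have /negP := h k; rewrite negbK => /eqP ->; rewrite mul0r.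
  move=> h0; have h1 : (fun=> 0 : R) @ \oo --> (0 : R) by exact: cvg_cst.
  by apply/eqP; exact: cvg_unique h0 h1.
pose j := ((l' + m.-1 * i) %% m)%N.
have ij : i + j = l' %[mod m] by rewrite modnDmr addnC neg.
have jres : j \in residues p.
  rewrite mem_residues ltn_mod m_gt0 /=; apply/negP => Pj.
  by have := bc i j ij; rewrite Pj => wi0; rewrite wi0 eqxx in wi.
have kr : (index j (residues p) < size (zeros p))%N.
  by rewrite -(size_residues m_gt0 last_zero) index_mem.
apply/rV0Pn; exists (Ordinal kr); rewrite mxE [pos _]nth_zeros // nth_index // /y.
have -> : c (l' + m.-1 * j)%N = c i.
  by apply: c_mod; apply/eqP; rewrite -(eqn_modDr j) neg ij.
by rewrite /c mulf_neq0 ?invr_neq0 ?expf_neq0 // fmorph_eq0.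
Qed.

End EigenDet.

(** * The recurrence for up-down numbers *)

Section SharpRecurrence.
Variable P : nat -> bool.
Local Open Scope nat_scope.

Definition matches n (s : 'S_n) := up_down (one_line s) == mkseq (fun k => P k.+1) n.-1.

Lemma size_one_line n (s : 'S_n) : size (one_line s) = n.
Proof. by rewrite size_map size_enum_ord. Qed.

(** Appending a last value to a standardised word: [bump j] opens the gap at [j]. Entries start at 1
    while ordinals start at 0, hence the predecessor and successor. *)
Lemma one_line_lift n (j : 'I_n.+1) (s : 'S_n) :
  one_line (lift_perm ord_max j s) =
  rcons [seq (bump j v.-1).+1 | v <- one_line s] j.+1.
Proof.
rewrite /one_line enum_ordSr map_rcons lift_perm_id; congr rcons.
rewrite -!map_comp; apply: eq_map => k /=.
have -> : widen_ord (leqnSn n) k = lift ord_max k by apply/val_inj; rewrite /= /bump leqNgt ltn_ord.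
by rewrite lift_perm_lift.
Qed.

Lemma one_line_gt0 n (s : 'S_n) v : v \in one_line s -> 0 < v.
Proof. by case/mapP => x _ ->. Qed.

Lemma up_down_rcons (h : nat -> nat) (w : seq nat) x : 0 < size w ->
  (forall u v, u \in w -> v \in w -> (h u < h v) = (u < v)) ->
  up_down (rcons (map h w) x) = rcons (up_down w) (h (last 0 w) < x).
Proof.
move=> w0 hmono; apply: (@eq_from_nth _ false).
  by rewrite size_rcons !size_mkseq size_rcons size_map prednK.
move=> k; rewrite size_mkseq size_rcons size_map /= => kw.
have su : size (up_down w) = (size w).-1 by rewrite size_mkseq.
rewrite nth_mkseq ?size_rcons ?size_map // [RHS]nth_rcons su !nth_rcons size_map kw.
have [k1|k1] := ltnP k.+1 (size w).
  have -> : k < (size w).-1 by rewrite -ltnS prednK.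
  rewrite (nth_map 0 0 h kw) (nth_map 0 0 h k1) nth_mkseq; last by rewrite -ltnS prednK.
  by rewrite hmono ?mem_nth.
have E : k.+1 = size w by apply/eqP; rewrite eqn_leq k1 kw.
have Ek : (size w).-1 = k by rewrite -E.
by rewrite -nth_last Ek -E !ltnn !eqxx (nth_map 0) // -E.
Qed.

Lemma matches_lift n (j : 'I_n.+2) (s : 'S_n.+1) :
  matches (lift_perm ord_max j s) =
  matches s && (((last 0 (one_line s)).-1 < j) == P n.+1).
Proof.
rewrite /matches one_line_lift up_down_rcons ?size_one_line //; last first.
  move=> u v /one_line_gt0 u0 /one_line_gt0 v0.
  by rewrite ltnS ltnNge leq_bump2 -ltnNge; case: u v u0 v0 => [|u] [|v].
rewrite /= mkseqS eqseq_rcons; congr (_ && (_ == _)).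
rewrite ltnS /bump; case: leqP => /= h; lia.
Qed.

Lemma lift_perm_bij n :
  bijective (fun js : 'I_n.+1 * 'S_n => lift_perm ord_max js.1 js.2).
Proof.
apply: inj_card_bij; last by rewrite card_prod card_ord !card_Sn.
move=> [j s] [j' s'] /= E.
have jj : j = j' by have := congr1 (fun t : 'S_n.+1 => t ord_max) E; rewrite !lift_perm_id.
subst j'; congr pair; apply/permP => k.
have := congr1 (fun t : 'S_n.+1 => t (lift ord_max k)) E.
by rewrite !lift_perm_lift => /lift_inj.
Qed.

Lemma sharp_sum n j : sharp P n j = \sum_(s : 'S_n | matches s) (last 0 (one_line s) == j).
Proof.
rewrite /sharp -sum1_card big_mkcond [RHS]big_mkcond; apply: eq_bigr => s _.
by rewrite inE /matches; case: (_ == mkseq _ _) => //=; case: (_ == j).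
Qed.

(** Delete the last entry and standardise; if the word then ends in k + 1, the final step was an
    ascent exactly when k < j. *)
Lemma sharp_rec n j : j <= n.+1 ->
  sharp P n.+2 j.+1 = \sum_(k < n.+1 | (k < j) == P n.+1) sharp P n.+1 k.+1.
Proof.
move=> jn; rewrite sharp_sum big_mkcond (reindex _ (onW_bij _ (lift_perm_bij n.+1))) /=.
rewrite -(pair_bigA _ (fun (a : 'I_n.+2) (s : 'S_n.+1) =>
  if matches (lift_perm ord_max a s) then
    nat_of_bool (last 0 (one_line (lift_perm ord_max a s)) == j.+1) else 0)) /=.
rewrite (bigD1 (Ordinal (jn : j < n.+2))) //= [X in _ + X]big1 ?addn0; last first.
  move=> a aj; rewrite big1 // => s _; case: ifP => // _.
  by rewrite one_line_lift last_rcons eqSS; move: aj; rewrite -val_eqE /= => /negbTE ->.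
under [RHS]eq_bigr => k _ do rewrite sharp_sum.
rewrite exchange_big /= [RHS]big_mkcond; apply: eq_bigr => s _.
rewrite matches_lift one_line_lift last_rcons /= eqxx.
case: (matches s) => //=.
have : last 0 (one_line s) \in one_line s.
  have := size_one_line s; case: (one_line s) => // a w _; exact: mem_last.
case/mapP => x _ ->; rewrite /= (bigID (pred1 (s x))) /=.
rewrite [X in _ + X]big1 ?addn0; last first.
  by move=> k /andP[_ kx]; rewrite eqSS eq_sym; move: kx; rewrite -val_eqE /= => /negbTE ->.
case: ifP => h.
  rewrite (big_pred1 (s x)) ?eqxx // => k /=.
  by case: (k =P s x) => [->|_]; rewrite ?h ?andbF.
by rewrite big_pred0 // => k /=; case: (k =P s x) => [->|_]; rewrite ?h ?andbF.
Qed.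

Lemma sharp11 : sharp P 1 1 = 1.
Proof.
rewrite /sharp (@eq_card _ _ predT); first exact: card_Sn 1.
move=> s; rewrite !inE /one_line enum_ordSr.
have -> : enum 'I_0 = [::] by apply/eqP; rewrite -size_eq0 size_enum_ord.
by rewrite /= (ord1 (s _)) eqxx.
Qed.

End SharpRecurrence.

(** * Bernstein form of the densities *)

Section Bernstein.
Variable R : realType.
Implicit Types (a b : nat -> R) (n : nat) (x c : R).

(* De Casteljau's recursion for the polynomial
   [\sum_(j <= n) a j * 'C(n, j) * x ^ j * (1 - x) ^ (n - j)]. *)
Fixpoint bern n a x : R :=
  if n is n'.+1 then (1 - x) * bern n' a x + x * bern n' (fun j => a j.+1) x
  else a 0%N.

Lemma eq_bern n a b x : (forall j, (j <= n)%N -> a j = b j) -> bern n a x = bern n b x.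
Proof.
elim: n a b => [|n IHn] a b ab /=; first exact: ab.
congr (_ * _ + _ * _); apply: IHn => j jn; apply: ab => //; exact: leqW.
Qed.

Lemma bern_lin n a b c d x :
  bern n (fun j => c * a j + d * b j) x = c * bern n a x + d * bern n b x.
Proof.
by elim: n a b => [//|n IHn] a b /=; rewrite !IHn; ring.
Qed.

Lemma bern_cst n c x : bern n (fun=> c) x = c.
Proof. by elim: n => [//|n IHn] /=; rewrite IHn; ring. Qed.

Lemma bern0 n a : bern n a 0 = a 0%N.
Proof. by elim: n a => [//|n IHn] a /=; rewrite !IHn; ring. Qed.

Lemma bern1 n a : bern n a 1 = a n.
Proof. by elim: n a => [//|n IHn] a /=; rewrite !IHn; ring. Qed.

Lemma bern_le n a b x : 0 <= x <= 1 -> (forall j, (j <= n)%N -> a j <= b j) ->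
  bern n a x <= bern n b x.
Proof.
move=> x01; elim: n a b => [|n IHn] a b ab /=; first exact: ab.
apply: lerD; apply: ler_wpM2l; try lra.
  by apply: IHn => j jn; apply: ab; exact: leqW.
by apply: IHn => j jn; exact: ab.
Qed.

(** The second moment about [c] of the binomial law with parameters [n] and [x]: variance plus
    squared bias. *)
Lemma bern_variance n c x :
  bern n (fun j => (j%:R - c) ^+ 2) x = n%:R * x * (1 - x) + (n%:R * x - c) ^+ 2.
Proof.
elim: n c => [|n IHn] c /=; first by rewrite !mul0r; ring.
rewrite IHn (eq_bern (b := fun j => (j%:R - (c - 1)) ^+ 2)).
  by rewrite IHn -natr1; ring.
by move=> j _; rewrite -natr1; ring.
Qed.

Lemma bern_deriv n a :
  deriv01 (bern n.+1 a) (fun x => n.+1%:R * bern n (fun j => a j.+1 - a j) x).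
Proof.
elim: n a => [|n IHn] a.
  apply: deriv01_eq (deriv01D (deriv01_cst (a 0%N))
    (deriv01Z (a 1%N - a 0%N) (@deriv01_id R))) => x _ /=; ring.
have d1 := IHn a; have d2 := IHn (fun j => a j.+1).
have dd := deriv01D d1 (deriv01_mulx (deriv01D d2 (deriv01N d1))).
apply: deriv01_eq dd => x _; first by rewrite /=; ring.
have E : bern n.+1 (fun j => a j.+1 - a j) x =
    bern n.+1 (fun j => a j.+1) x - bern n.+1 a x.
  rewrite (eq_bern (b := fun j => 1 * a j.+1 + (-1) * a j)).
    by rewrite bern_lin; ring.
  by move=> j _; ring.
have E2 : bern n.+1 (fun j => a j.+1 - a j) x =
  (1 - x) * bern n (fun j => a j.+1 - a j) x + x * bern n (fun j => a j.+2 - a j.+1) x by [].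
rewrite -(natr1 n.+1) mulrDl mul1r {1}E2 E; ring.
Qed.

Lemma bern_coef n a L x i (d : R) : 0 <= x <= 1 -> 0 <= L -> 0 < d -> (i <= n)%N ->
  (forall j, (j < n)%N -> `|a j.+1 - a j| <= L) ->
  `|bern n a x - a i| <= L / 2 * (d + (n%:R * x * (1 - x) + (n%:R * x - i%:R) ^+ 2) / d).
Proof.
move=> x01 L0 d0 le_in aL.
have lip j k : (j + k <= n)%N -> `|a (j + k)%N - a j| <= L * k%:R.
  elim: k => [|k IHk] jk; first by rewrite addn0 subrr normr0 mulr0.
  rewrite addnS in jk *.
  have -> : a (j + k).+1 - a j = (a (j + k).+1 - a (j + k)%N) + (a (j + k)%N - a j) by ring.
  apply: le_trans (ler_normD _ _) _; rewrite -natr1 mulrDr mulr1 addrC.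
  by apply: lerD; [apply: IHk; exact: ltnW|exact: aL].
have amgm (z : R) : 0 <= z -> z <= 1 / 2 * (d + z ^+ 2 / d).
  move=> z0; rewrite -subr_ge0.
  have -> : 1 / 2 * (d + z ^+ 2 / d) - z = (d - z) ^+ 2 / (2 * d) by field; rewrite gt_eqF.
  by rewrite mulr_ge0 ?sqr_ge0 // invr_ge0; lra.
have pt j : (j <= n)%N -> `|a j - a i| <= L / 2 * d + L / 2 / d * (j%:R - i%:R) ^+ 2.
  move=> jn.
  have h : `|a j - a i| <= L * `|j%:R - i%:R|.
    have [ij|/ltnW ji] := leqP i j.
      by have := @lip i (j - i)%N; rewrite subnKC // natrB // [`|_ - i%:R|]ger0_norm ?subr_ge0 ?ler_nat //; apply.
    have := @lip j (i - j)%N; rewrite subnKC // natrB // distrC [`|j%:R - _|]distrC.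
    by rewrite [`|_ - j%:R|]ger0_norm ?subr_ge0 ?ler_nat //; apply.
  have := ler_wpM2l L0 (amgm _ (normr_ge0 (j%:R - i%:R : R))).
  rewrite real_normK ?num_real // => h2; apply: le_trans h _; apply: le_trans h2 _.
  by rewrite le_eqVlt; apply/orP; left; apply/eqP; field; rewrite gt_eqF.
(* Used with [e] equal to 1 and -1 for the two signs. *)
have bound : forall e : R, (forall j, (j <= n)%N ->
      e * a j + (- e) * a i <= L / 2 * d + L / 2 / d * (j%:R - i%:R) ^+ 2) ->
    e * (bern n a x - a i) <=
      L / 2 * (d + (n%:R * x * (1 - x) + (n%:R * x - i%:R) ^+ 2) / d).
  move=> e he; have := bern_le x01 he.
  rewrite (bern_lin n a (fun=> a i)) bern_cst.
  rewrite (@eq_bern n (fun j => L / 2 * d + L / 2 / d * (j%:R - i%:R) ^+ 2)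
    (fun j => (L / 2 * d) * 1 + L / 2 / d * (j%:R - i%:R) ^+ 2)); last first.
    by move=> j _; rewrite mulr1.
  rewrite (bern_lin n (fun=> 1)) bern_cst bern_variance mulr1 => h.
  have -> : e * (bern n a x - a i) = e * bern n a x + - e * a i by ring.
  by apply: le_trans h _; rewrite le_eqVlt; apply/orP; left; apply/eqP; field; rewrite gt_eqF.
have b1 := bound 1; have b2 := bound (-1).
rewrite ler_norml; apply/andP; split.
  rewrite lerNl -[leLHS]mulN1r; apply: b2 => j jn; apply: le_trans (pt j jn).
  by rewrite opprK mul1r mulN1r addrC distrC ler_norm.
rewrite -[leLHS]mul1r; apply: b1 => j jn; apply: le_trans (pt j jn).
by rewrite mul1r mulN1r ler_norm.
Qed.

End Bernstein.

Section Densities.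
Variables (R : realType) (P : nat -> bool).
Local Notation Q := (fun n => P n.+1).

(** Indices start at 0: [coef n] and [density n] belong to permutations of length n + 1, hence the
    normalisation n!. *)
Definition coef n j : R := (sharp P n.+1 j.+1)%:R / n`!%:R.

Definition density n x : R := bern n (coef n) x.

Lemma coef_ge0 n j : 0 <= coef n j.
Proof. by rewrite mulr_ge0 // invr_ge0. Qed.

Lemma coef_rec n j : (j <= n.+1)%N ->
  coef n.+1 j = (\sum_(k < n.+1 | (k < j)%N == Q n) coef n k) / n.+1%:R.
Proof.
move=> jn; rewrite /coef sharp_rec // natr_sum factS natrM invfM mulrA mulrAC.
by rewrite mulr_suml.
Qed.

(** Discrete form of the recursion: the index sets of the two sums differ by [j] alone. It also
    gives the Lipschitz bound in [j]. *)
Lemma coef_step n j : (j <= n)%N ->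
  coef n.+1 j.+1 - coef n.+1 j = sgnb R (Q n) * coef n j / n.+1%:R.
Proof.
move=> jn; rewrite !coef_rec //; last exact: leqW.
rewrite -mulrBl; congr (_ / _).
have jn1 : (j < n.+1)%N by [].
case: (Q n); rewrite /sgnb.
  rewrite (bigD1 (Ordinal jn1)) /= ?ltnSn // mul1r.
  rewrite (eq_bigl (fun k : 'I_n.+1 => (k < j)%N == true)) ?addrK // => k.
  by rewrite -val_eqE /= !eqb_id ltnS ltn_neqAle andbC.
rewrite mulN1r [X in _ - X](bigD1 (Ordinal jn1)) /= ?ltnn //.
rewrite [X in X - _](eq_bigl (fun k : 'I_n.+1 => ((k < j)%N == false) && (k != Ordinal jn1))).
  by rewrite opprD addrCA subrr addr0.
move=> k; rewrite -val_eqE /= !eqbF_neg -!leqNgt ltn_neqAle eq_sym andbC //.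
Qed.

Lemma coef_bc n : if Q n then coef n.+1 0 = 0 else coef n.+1 n.+1 = 0.
Proof.
case: ifP => h; rewrite coef_rec // big_pred0 ?mul0r // => k; rewrite h //.
by rewrite ltn_ord.
Qed.

Lemma density_tseq : tseq Q density.
Proof.
move=> n; split; last first.
  by have := coef_bc n; rewrite /density bern0 bern1.
apply: deriv01_eq (bern_deriv n (coef n.+1)) => // x _.
rewrite (eq_bern (b := fun j => sgnb R (Q n) / n.+1%:R * coef n j + 0 * 0)).
  rewrite (bern_lin n _ (fun=> 0)) mul0r addr0 /density mulrA.
  by congr (_ * _); rewrite mulrCA mulfV ?mulr1 // pnatr_eq0.
by move=> j jn; rewrite coef_step // mul0r addr0 mulrAC.
Qed.

Lemma density0 x : density 0 x = 1.
Proof. by rewrite /density /= /coef sharp11 fact0 divr1. Qed.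

(* [coef n] is monotone in [j], so its maximum is the value of the density at
   an endpoint. *)
Lemma coef_le n j K : (j <= n)%N -> (forall x, 0 <= x <= 1 -> density n x <= K) ->
  coef n j <= K.
Proof.
move=> jn hK; have h0 : coef n 0 <= K by rewrite -(bern0 n) hK //; lra.
have h1 : coef n n <= K by rewrite -(bern1 n (coef n)) hK //; lra.
case: n jn hK h0 h1 => [|n] jn hK h0 h1; first by move: jn; rewrite leqn0 => /eqP ->.
have step i : (i <= n)%N -> 0 <= sgnb R (Q n) * (coef n.+1 i.+1 - coef n.+1 i).
  by move=> le_in; rewrite coef_step // !mulrA sgnb_mul mul1r mulr_ge0 ?coef_ge0 // invr_ge0.
case: (Q n) step => step.
  have mono k : (j + k <= n.+1)%N -> coef n.+1 j <= coef n.+1 (j + k)%N.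
    elim: k => [|k IHk] jk; first by rewrite addn0.
    rewrite addnS in jk *; apply: le_trans (IHk (ltnW jk)) _.
    by have := step _ jk; rewrite mul1r subr_ge0.
  by apply: le_trans h1; have := mono (n.+1 - j)%N; rewrite subnKC //; apply.
apply: le_trans h0; elim: j jn => [//|j IHj] jn.
apply: le_trans (IHj (ltnW jn)).
by have := step j jn; rewrite mulN1r oppr_ge0 subr_le0.
Qed.

End Densities.

(** * Asymptotics of up-down numbers *)

Section AllZeros.
Variables (R : realType) (m : nat) (p : m.-tuple bool).
Hypothesis m_gt0 : (0 < m)%N.
Local Notation Q := (fun n => periodic_seq p n.+1).
Hypothesis Q0 : forall n, Q n = false.

Lemma prim_expn_rev n : prim false (fun x : R => (1 - x) ^+ n.+1 / n.+1`!%:R)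
                                   (fun x => (1 - x) ^+ n / n`!%:R).
Proof.
have d k : deriv01 (fun x : R => (1 - x) ^+ k.+1) (fun x => - k.+1%:R * (1 - x) ^+ k).
  elim: k => [|k IHk].
    apply: deriv01_eq (deriv01D (deriv01_cst 1) (deriv01N (@deriv01_id R))) => x _.
      by rewrite expr1.
    by rewrite expr0; ring.
  apply: deriv01_eq (deriv01D IHk (deriv01N (deriv01_mulx IHk))) => x _.
    by rewrite [in RHS]exprS; ring.
  by rewrite [in RHS]exprS -[in RHS]natr1 exprS; ring.
split; last by rewrite subrr expr0n mul0r.
apply: deriv01_eq (deriv01Z (n.+1`!%:R^-1) (d n)) => x _; first by rewrite mulrC.
have f0 : n`!%:R != 0 :> R by rewrite pnatr_eq0 -lt0n fact_gt0.
have n0 : n.+1%:R != 0 :> R by rewrite pnatr_eq0.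
rewrite /sgnb factS natrM; move: n`! (n.+1%:R : R) f0 n0 => k y f0 n0.
by field; rewrite f0.
Qed.

(** An eigenfunction would scale by [lambda ^- m] each period, yet it is dominated by a multiple of
    (1 - x)^n / n!, which decays faster. *)
Lemma all_zeros_no_eigenfunction l (lambda : R) u : (l < m)%N -> 0 < lambda ->
  ~ eigenfunction p l lambda u.
Proof.
move=> lm la0 [sol [x]]; rewrite in_itv /= => x01 /eqP; apply.
have [G [tG [K GK] G_per ->//]] := eigen_tseq m_gt0 lm la0 sol.
set n := (m + l - 1)%N; suff -> : G n x = 0 by rewrite mulr0.
have tH : tseq Q (fun n (x : R) => (1 - x) ^+ n / n`!%:R).
  by move=> k /=; rewrite Q0; exact: prim_expn_rev.
have H0 (y : R) : (1 - y) ^+ 0 / 0`!%:R = 1 by rewrite expr0 fact0 divr1.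
have dom k : `|G k x| <= K / k`!%:R.
  apply: le_trans (unit_start_dom (g := fun n (x : R) => (1 - x) ^+ n / n`!%:R) tH (fun y _ => H0 y) tG GK k x01) _.
  have K0 : 0 <= K by apply: le_trans (GK x x01).
  rewrite ler_wpM2l // ler_piMl ?invr_ge0 // exprn_ile1; lra.
have G_perk k : G n x = lambda ^+ (m * k) * G (m * k + n)%N x.
  elim: k => [|k IHk]; first by rewrite muln0 mul1r.
  have -> : (m * k.+1 + n = m * k + n + m)%N by rewrite mulnS -addnA [(m + _)%N]addnC.
  rewrite G_per // mulnS addnC exprD IHk mulrA mulrK ?unitfE //.
  by rewrite expf_neq0 // gt_eqF.
apply/eqP; rewrite -normr_le0.
have cv : K / lambda ^+ n * exp_coeff lambda (m * k + n)%N @[k --> \oo] --> K / lambda ^+ n * 0.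
  apply: cvgM; first exact: cvg_cst.
  apply: (cvg_comp _ _ _ (cvg_exp_coeff lambda)).
  apply/cvgnyPge => N; exists N => // k /= Nk; apply: leq_trans Nk _.
  by apply: leq_trans (leq_addr _ _); exact: leq_pmull.
rewrite -(mulr0 (K / lambda ^+ n)); apply: (cvgr_to_ge cv); apply: nearW => k.
rewrite (G_perk k) normrM ger0_norm ?exprn_ge0 ?(ltW la0) //.
apply: le_trans (ler_wpM2l (exprn_ge0 _ (ltW la0)) (dom _)) _.
rewrite le_eqVlt; apply/orP; left; apply/eqP; rewrite /exp_coeff /= exprD.
have := fact_gt0 (m * k + n); move: (_`!) => f f0.
have fr : (f%:R : R) != 0 by rewrite pnatr_eq0 -lt0n.
by field; rewrite fr expf_neq0 // gt_eqF.
Qed.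

End AllZeros.

Lemma exists_expr_root (R : realType) (m : nat) (a : R) : (0 < m)%N -> 0 < a ->
  exists2 b : R, 0 < b & b ^+ m = a.
Proof.
move=> m0 a0; exists (expR (ln a / m%:R)); first exact: expR_gt0.
rewrite -expRM_natl mulrC divfK ?lnK //.
by rewrite pnatr_eq0 -lt0n.
Qed.

(** Fix [d] of order h / (2(K + 1)) first; eventually e_n <= d^2, and both terms in the bracket are
    then at most [d]. *)
Lemma cvg_amgm (R : realType) (x e : nat -> R) (K : R) : 0 <= K ->
  (forall n, 0 <= x n) -> (forall n d, 0 < d -> x n <= K * (d + e n / d)) ->
  e @ \oo --> 0 -> x @ \oo --> 0.
Proof.
move=> K0 x0 xe ce; apply/cvgrPdist_le => h h0.
pose d := h / 2 / (K + 1); have d0 : 0 < d by rewrite !divr_gt0 //; lra.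
move/cvgrPdist_le: ce => /(_ _ (mulr_gt0 d0 d0)); apply: filterS => n.
rewrite !sub0r !normrN (ger0_norm (x0 n)) => en.
apply: le_trans (xe n d d0) _.
have h1 : e n / d <= d.
  by rewrite ler_pdivrMr //; apply: le_trans (ler_norm _) en.
apply: (@le_trans _ _ ((K + 1) * (d + d))).
  apply: (@le_trans _ _ (K * (d + d))); first by rewrite ler_wpM2l // lerD2l.
  by rewrite ler_wpM2r //; lra.
have K1 : K + 1 != 0 by apply: lt0r_neq0; lra.
by rewrite le_eqVlt; apply/orP; left; apply/eqP; rewrite /d; field.
Qed.

Section Mixed.
Variables (R : realType) (m : nat) (p : m.-tuple bool).
Hypothesis m_gt1 : (1 < m)%N.
Local Notation P := (periodic_seq p).
Local Notation Q := (fun n => periodic_seq p n.+1).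
Local Notation nc := (@complex.ComplexField.Normc.normc R).
Local Notation g := (@density R P).

Let m_gt0 : (0 < m)%N. Proof. exact: ltnW. Qed.

Variables (lambda0 gam B : R) (F : nat -> R -> R).
Hypothesis gam_gt0 : 0 < gam.
Hypothesis lambda0_gt0 : 0 < lambda0.
Hypothesis gam_lambda0 : gam * lambda0 ^+ m = 1.
Hypothesis tF : tseq Q F.
Hypothesis F_per : forall n x, 0 <= x <= 1 -> F (n + m)%N x = gam * F n x.
Hypothesis F_lim : forall n x, 0 <= x <= 1 ->
  g (m * k + n)%N x / gam ^+ k @[k --> \oo] --> F n x.
Hypothesis g_le : forall k n x, 0 <= x <= 1 -> g (m * k + n)%N x <= B * gam ^+ k.
Hypothesis F_neq0 : forall n, exists2 x, 0 <= x <= 1 & F n x != 0.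
Hypothesis F_uniq : forall G, tseq Q G ->
  (exists C, forall x, 0 <= x <= 1 -> `|G 0%N x| <= C) ->
  (forall n x, 0 <= x <= 1 -> G (n + m)%N x = gam * G n x) ->
  exists c, forall n x, 0 <= x <= 1 -> G n x = c * F n x.

Lemma B_ge0 : 0 <= B.
Proof.
have i0 : 0 <= (0 : R) <= 1 by lra.
have := @g_le 0 0 0 i0; rewrite muln0 addn0 density0 expr0 mulr1; lra.
Qed.

Lemma growth G : tseq Q G -> (exists K, forall x, 0 <= x <= 1 -> `|G 0%N x| <= K) ->
  exists K, forall k n x, 0 <= x <= 1 -> `|G (m * k + n)%N x| <= K * gam ^+ k.
Proof.
move=> tG [K GK]; exists (K * B) => k n x x01.
have K0 : 0 <= K by apply: le_trans (GK x x01).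
apply: le_trans (unit_start_dom (density_tseq R P) (fun x _ => @density0 R P x) tG GK _ x01) _.
by rewrite -mulrA ler_wpM2l // g_le.
Qed.

Lemma det_root_lambda0 (t : R[i]) : last 0%N (zeros p) = m ->
  \det (olivier_matrix p t) = 0 -> lambda0 <= nc t.
Proof.
move=> last_zero /(det_root_ge m_gt0 last_zero gam_gt0 growth); rewrite -gam_lambda0.
by rewrite ler_pM2l // ler_pXn2r // nnegrE ?normc_ge0 // ltW.
Qed.

(** [F] yields an eigenfunction at [lambda0], so [lambda <= lambda0]; conversely [lambda] is the
    modulus of a determinant root. *)
Lemma first_eigenvalue_lambda0 l lambda : last 0%N (zeros p) = m -> (l < m)%N ->
  first_eigenvalue p l lambda -> lambda = lambda0.
Proof.
move=> last_zero lm [la0 [u eu] min_la]; apply/eqP; rewrite eq_le; apply/andP; split; last first.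
  have [t [det0 <-]] := eigen_det m_gt0 last_zero lm la0 eu.
  exact: det_root_lambda0.
apply: min_la => //; eexists; split; first exact: (tseq_eigen m_gt0 lm tF F_per gam_lambda0).
have [x x01 Fx] := F_neq0 (m + (m + l - 1)).
by exists x; rewrite ?in_itv //= mulf_neq0 // eps_neq0.
Qed.

Lemma F_ge0 n x : 0 <= x <= 1 -> 0 <= F n x.
Proof.
move=> x01; apply: (cvgr_to_ge (@F_lim n x x01)); apply: nearW => k.
rewrite mulr_ge0 ?invr_ge0 ?exprn_ge0 ?(ltW gam_gt0) //.
exact: unit_start_ge0 (density_tseq R P) (fun x _ => @density0 R P x) _ _ x01.
Qed.

(** By uniqueness u = k F. As [F] is nonnegative and [u] attains 1, [k] is positive, so both are
    maximal at the same point and 1 / k is the supremum of [F]. *)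
Lemma eigenfunction_F l u : (l < m)%N -> eigenfunction p l lambda0 u -> max_on01 u 1 ->
  forall t, 0 <= t <= 1 ->
    sup [set F (m + l - 1)%N x | x in `[0, 1]%classic] * u t = F (m + l - 1)%N t.
Proof.
move=> lm [sol _] [u1 [x1]]; rewrite in_itv /= => x101 ux1 t t01.
have [G [tG GK G_per uG]] := eigen_tseq m_gt0 lm lambda0_gt0 sol.
have la_gam : lambda0 ^- m = gam.
  have L0 : lambda0 ^+ m != 0 by rewrite expf_neq0 // gt_eqF.
  by rewrite -[RHS](mulfK L0) gam_lambda0 mul1r.
have [c Gc] : exists c, forall n x, 0 <= x <= 1 -> G n x = c * F n x.
  by apply: F_uniq => // n x x01; rewrite G_per // la_gam.
set n := (m + l - 1)%N in uG *; pose k := eps R p n * c.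
have uF x : 0 <= x <= 1 -> u x = k * F n x.
  by move=> x01; rewrite uG // Gc // mulrA.
have kF : k * F n x1 = 1 by rewrite -uF.
have k0 : 0 < k.
  rewrite ltNge; apply/negP => k0; have := mulr_le0_ge0 k0 (F_ge0 n x101); rewrite kF; lra.
have Fle x : 0 <= x <= 1 -> F n x <= F n x1.
  move=> x01; rewrite -(ler_pM2l k0) kF -uF //; apply: u1; by rewrite in_itv.
have -> : sup [set F n x | x in `[0, 1]%classic] = F n x1.
  apply/eqP; rewrite eq_le; apply/andP; split.
    apply: ge_sup; first by exists (F n x1), x1 => //=; rewrite in_itv.
    by move=> _ [x /= + <-]; rewrite in_itv /= => /Fle.
  apply: ub_le_sup; last by exists x1 => //=; rewrite in_itv.
  by exists (F n x1) => _ [x /= + <-]; rewrite in_itv /= => /Fle.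
by rewrite uF // mulrA [F n x1 * k]mulrC kF mul1r.
Qed.

Lemma sharp_cvg l (t : R) (j : nat -> nat) : (l < m)%N -> 0 <= t <= 1 ->
  (forall n, (0 < n)%N -> (1 <= j n <= m * n + l)%N) ->
  ((j n)%:R / (m * n + l)%:R : R) @[n --> \oo] --> t ->
  ((sharp P (m * n + l) (j n))%:R * lambda0 ^+ (m * n + l)
     / ((m * n + l - 1)`!)%:R : R) @[n --> \oo] -->
  lambda0 ^+ (m + l) * F (m + l - 1)%N t.
Proof.
move=> lm t01 jP jt.
(* The limit is taken along n + 1, so that [N n] and [i n], the zero-based length and last entry,
   are true predecessors. *)
pose N n := (m * n + (m + l - 1))%N; pose i n := (j n.+1).-1.
have NE n : (m * n.+1 + l = (N n).+1)%N by rewrite /N mulnS; lia.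
(* Since m > 1, m + l - 2 is a true subtraction even for l = 0, and the previous coefficients obey
   the same bound [B * gam ^+ n]. *)
have Np n : (N n).-1 = (m * n + (m + l - 2))%N.
  by rewrite /N -subn1 -addnBA -?subnDA // subn_gt0 (leq_trans m_gt1) // leq_addr.
have nN n : (n < N n)%N.
  have : (n * 1 <= m * n)%N by rewrite mulnC leq_mul2r m_gt0 orbT.
  by rewrite /N; lia.
have N_gt0 n : 0 < (N n)%:R :> R by rewrite ltr0n; exact: leq_ltn_trans (nN n).
have iN n : (i n <= N n)%N.
  by have := jP n.+1 isT; rewrite NE /i; lia.
have jE n : j n.+1 = (i n).+1 by have := jP n.+1 isT; rewrite /i; lia.
have pow n : lambda0 ^+ (N n).+1 = lambda0 ^+ (m + l) / gam ^+ n.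
  have -> : ((N n).+1 = m + l + m * n)%N by rewrite /N; lia.
  rewrite exprD exprM; congr (_ * _); apply: (mulIf (expf_neq0 n (lt0r_neq0 gam_gt0))).
  by rewrite mulVf ?expf_neq0 ?lt0r_neq0 // -exprMn mulrC gam_lambda0 expr1n.
rewrite -cvg_shiftS.
pose u n := coef R P (N n) (i n) * lambda0 ^+ (N n).+1.
pose v n := g (N n) t * lambda0 ^+ (N n).+1.
have -> : (fun n => (sharp P (m * n.+1 + l) (j n.+1))%:R * lambda0 ^+ (m * n.+1 + l)
     / ((m * n.+1 + l - 1)`!)%:R) = u.
  by apply/funext => n; rewrite NE jE subn1 /= /u /coef mulrAC.
have v_cvg : v @ \oo --> lambda0 ^+ (m + l) * F (m + l - 1)%N t.
  have -> : v = fun n => lambda0 ^+ (m + l) * (g (m * n + (m + l - 1))%N t / gam ^+ n).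
    by apply/funext => n; rewrite /v pow /N; ring.
  by apply: cvgM; [exact: cvg_cst|exact: F_lim].
pose e n : R := t * (1 - t) / (N n)%:R + (t - (i n)%:R / (N n)%:R) ^+ 2.
have invN : (N n)%:R^-1 @[n --> \oo] --> (0 : R).
  apply: (@squeeze_cvgr _ _ _ _ (fun=> 0) (@harmonic R)); last exact: cvg_harmonic.
    apply: nearW => n; rewrite invr_ge0 ler0n /= /harmonic /= lef_pV2 ?posrE ?N_gt0 //.
    by rewrite ler_nat.
  exact: cvg_cst.
have iN_cvg : ((i n)%:R / (N n)%:R : R) @[n --> \oo] --> t.
  have -> : (fun n => (i n)%:R / (N n)%:R : R) =
     (fun n => (j n.+1)%:R / (m * n.+1 + l)%:R * (1 + (N n)%:R^-1) - (N n)%:R^-1).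
    apply/funext => n; rewrite NE jE -!natr1; field.
    by rewrite !lt0r_neq0 // ltr_wpDl.
  rewrite -[t in _ --> t](_ : t * (1 + 0) - 0 = t); last by ring.
  apply: cvgB => //; apply: cvgM; last by apply: cvgD => //; exact: cvg_cst.
  by have := jt; rewrite -cvg_shiftS.
have e_cvg : e @ \oo --> 0.
  have -> : (0 : R) = t * (1 - t) * 0 + (t - t) * (t - t) by rewrite subrr !mulr0 addr0.
  apply: cvgD; first by apply: cvgM => //; exact: cvg_cst.
  have h : (fun n => t - (i n)%:R / (N n)%:R) @ \oo --> t - t.
    by apply: cvgB => //; exact: cvg_cst.
  by have h2 := h; exact: cvgM h h2.
have uv : (fun n => `|u n - v n|) @ \oo --> 0.
  apply: (@cvg_amgm _ _ e (lambda0 ^+ (m + l) * B / 2)) => //.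
    by rewrite !mulr_ge0 ?invr_ge0 ?exprn_ge0 ?B_ge0 ?ltW.
  move=> n d d0; have N1 : N n = (N n).-1.+1 by rewrite prednK // -(ltr0n R).
  have gk : 0 < gam ^+ n by rewrite exprn_gt0.
  pose L := B * gam ^+ n / (N n)%:R.
  have L0 : 0 <= L by rewrite !mulr_ge0 ?invr_ge0 ?B_ge0 // ltW.
  have lip k : (k < N n)%N -> `|coef R P (N n) k.+1 - coef R P (N n) k| <= L.
    rewrite N1 => kN; rewrite coef_step // -N1 normrM normfV normrM.
    have sg b : `|sgnb R b| = 1 by case: b; rewrite /sgnb ?normrN1 ?normr1.
    rewrite sg mul1r !ger0_norm ?coef_ge0 // /L ler_wpM2r ?invr_ge0 //.
    apply: coef_le => // x x01.
    by rewrite Np; exact: g_le.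
  (* Taking [d] at scale [N n] cancels the 1 / N in [L], leaving a bound of the form K (d + e_n /
     d). *)
  have := bern_coef t01 L0 (mulr_gt0 d0 (N_gt0 n)) (iN n) lip.
  rewrite distrC => h; rewrite /u /v -mulrBl normrM [`|lambda0 ^+ _|]ger0_norm ?exprn_ge0 ?(ltW lambda0_gt0) //.
  rewrite pow.
  have w0 : 0 <= lambda0 ^+ (m + l) / gam ^+ n by rewrite mulr_ge0 ?invr_ge0 ?exprn_ge0 // ltW.
  apply: le_trans (ler_wpM2r w0 h) _.
  rewrite le_eqVlt; apply/orP; left; apply/eqP; rewrite /L /e; field.
  by rewrite !lt0r_neq0.
have -> : u = (fun n => v n + (u n - v n)) by apply/funext => n; rewrite addrC subrK.
rewrite -[lambda0 ^+ (m + l) * _]addr0; apply: cvgD => //; exact: norm_cvg0.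
Qed.

End Mixed.

Theorem theorem2 (R : realType) (m : nat) (p : m.-tuple bool)
    (m_gt1 : (1 < m)%N) (last_zero : last 0%N (zeros p) = m) :
  (exists c : nat -> R,
     forall (l : nat) (lambda : R) (u : R -> R), (l < m)%N ->
       first_eigenvalue p l lambda ->
       eigenfunction p l lambda u ->
       max_on01 u 1 ->
       forall (t : R) (j : nat -> nat), t \in `[0, 1] ->
         (forall n, (0 < n)%N -> (1 <= j n <= m * n + l)%N) ->
         ((j n)%:R / (m * n + l)%:R : R) @[n --> \oo] --> t ->
         ((sharp (periodic_seq p) (m * n + l) (j n))%:R * lambda ^+ (m * n + l)
            / ((m * n + l - 1)`!)%:R : R) @[n --> \oo] --> c l * u t)
  /\
  (forall (l : nat) (lambda : R), (l < m)%N ->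
     first_eigenvalue p l lambda ->
     (exists2 t : R[i], \det (olivier_matrix p t) = 0 & `|t| = (lambda%:C)%C)
     /\ (forall t : R[i], \det (olivier_matrix p t) = 0 ->
           (lambda%:C)%C <= `|t|)).
Proof.
have m_gt0 : (0 < m)%N by exact: ltnW.
(* If [p] has no 1, no first eigenvalue exists, and any constants serve. *)
have [Q_one|Q_none] := pselect (exists i, periodic_seq p i.+1); last first.
  have no_eigen l (lambda : R) : (l < m)%N -> ~ first_eigenvalue p l lambda.
    move=> lm [la0 [u eu] _]; apply: (all_zeros_no_eigenfunction m_gt0 _ lm la0 eu) => n.
    by apply/negP => Qn; apply: Q_none; exists n.
  by split=> [|l lambda lm /(no_eigen _ _ lm)//]; exists (fun=> 0) => l lambda u lm /(no_eigen _ _ lm).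
have Q_per n : periodic_seq p (n + m).+1 = periodic_seq p n.+1.
  by apply: periodic_seq_mod; rewrite -addSn modnDr.
have Q_last : periodic_seq p m.-1.+1 = false by rewrite prednK // periodic_seq_last.
have [gam [F [gam_gt0 [tF F_per] [F_lim [B g_le]] F_neq0 F_uniq]]] :=
  @perron R m (fun n => periodic_seq p n.+1) (density (periodic_seq p))
    m_gt0 Q_per Q_last Q_one (@density_tseq R _) (fun x _ => @density0 R _ x).
have [lambda0 la0 laE] : exists2 b : R, 0 < b & b ^+ m = gam^-1.
  by apply: exists_expr_root => //; rewrite invr_gt0.
have gam_la : gam * lambda0 ^+ m = 1 by rewrite laE mulfV ?gt_eqF.
have first_la l lambda : (l < m)%N -> first_eigenvalue p l lambda -> lambda = lambda0.
  exact: (first_eigenvalue_lambda0 m_gt1 gam_gt0 la0 gam_la tF F_per g_le F_neq0 last_zero).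
split.
  (* The supremum converts [F] to the normalisation max u = 1; the power of [lambda0] is what
     remains of [lambda0 ^+ (m * n + l)] after the scaling by [gam] along n - 1 periods. *)
  exists (fun l => lambda0 ^+ (m + l) *
    sup [set F (m + l - 1)%N x | x in `[0, 1]%classic]).
  move=> l lambda u lm fe; rewrite (first_la l lambda lm fe) => eu u1 t j.
  rewrite in_itv /= => t01 jP jt; rewrite -mulrA.
  rewrite (eigenfunction_F m_gt1 gam_gt0 la0 gam_la F_lim F_uniq lm eu u1 t01).
  exact: (sharp_cvg m_gt1 gam_gt0 la0 gam_la F_lim g_le).
move=> l lambda lm fe; rewrite (first_la l lambda lm fe).
split => [|t det0]; last first.
  by have := det_root_lambda0 m_gt1 gam_gt0 la0 gam_la g_le last_zero det0; rewrite -lecR.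
have [la1 [u eu] _] := fe; have [t [det0 nct]] := eigen_det m_gt0 last_zero lm la1 eu.
by exists t => //; rewrite -(first_la l lambda lm fe) -nct.
Qed.
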